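(* Let $(R,\mathfrak m,k)$ be an equicharacteristic Cohen-Macaulay local ring of dimension $d$ with infinite residue field and let $I$ be an $\mathfrak m$-primary ideal. If $I$ is stretched with respect to a minimal reduction $H$ of $I$, then $I$ is stretched with respect to any general minimal reduction of $I$.
   Context: $\lambda$ denotes length. An ideal $J\subseteq I$ is a reduction of $I$ if $I^{n+1}=JI^n$ for some $n\ge0$; it is minimal if minimal under inclusion. An $\mathfrak m$-primary ideal $I$ is stretched with respect to a minimal reduction $H$ of $I$ if $H\cap I^2=HI$ and $\lambda\big(I^2/((H\cap I^2)+I^3)\big)\le1$. A general minimal reduction: fix generators $I=(a_1,\dots,a_s)$. An assertion holds for any general minimal reduction if there is a Zariski dense open subset $U\subseteq k^{ds}$ such that it holds for $J=(x_1,\dots,x_d)$ whenever $x_i=\sum_{j}\lambda_{ij}a_j$ with $(\lambda_{ij})\in R^{ds}$ whose image in $k^{ds}$ lies in $U$. *)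

(* Defs.v *)
From HB Require Import structures.
From mathcomp Require Import all_boot all_order all_algebra.
From mathcomp Require Import mathcomp_extra boolp classical_sets functions cardinality.
From mathcomp Require Import mpoly.

Set Implicit Arguments.
Unset Strict Implicit.
Unset Printing Implicit Defensive.

Import GRing.Theory.

Local Open Scope classical_set_scope.
Local Open Scope ring_scope.

Section Ideals.
Variable R : comNzRingType.
Implicit Types (I J M N P Q m : set R).

(* [idealr_closed] of ring_quotient only describes proper ideals, given as
   boolean predicates; here the unit ideal is allowed. *)
Definition is_ideal I : Prop :=
  [/\ I 0, (forall x y, I x -> I y -> I (x + y)) & (forall r x, I x -> I (r * x))].

Definition ideal_gen (G : set R) : set R := smallest is_ideal G.

Definition ideal_add I J : set R := [set x + y | x in I & y in J].

Definition ideal_mul I J : set R := ideal_gen [set x * y | x in I & y in J].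

Definition ideal_exp I (n : nat) : set R := iter n (ideal_mul I) setT.

Definition prime_ideal P : Prop :=
  [/\ is_ideal P, ~ P 1 & forall x y, P (x * y) -> P x \/ P y].

Definition maximal_ideal m : Prop :=
  [/\ is_ideal m, ~ m 1 & forall J, is_ideal J -> m `<=` J -> ~ J 1 -> J = m].

Definition radical I : set R := [set x | exists n : nat, I (x ^+ n)].

Definition primary_ideal Q : Prop :=
  [/\ is_ideal Q, ~ Q 1 & forall x y, Q (x * y) -> Q x \/ radical Q y].

Definition primary_to m Q : Prop := primary_ideal Q /\ radical Q = m.

Definition noetherian : Prop :=
  forall I, is_ideal I -> exists s : seq R, I = ideal_gen [set` s].

Definition noetherian_local m : Prop :=
  [/\ noetherian, maximal_ideal m & forall m', maximal_ideal m' -> m' = m].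

(* There is a chain C 0 < C 1 < ... < C n of sets satisfying S; only the values
   of C at 0, ..., n matter. *)
Definition strict_chain (S : set (set R)) (n : nat) : Prop :=
  exists C : nat -> set R,
    (forall i, (i <= n)%N -> S (C i)) /\ (forall i, (i < n)%N -> C i `<` C i.+1).

Definition is_max (S : set nat) (n : nat) : Prop :=
  S n /\ forall l, S l -> (l <= n)%N.

Definition has_krull_dim (d : nat) : Prop := is_max (strict_chain prime_ideal) d.

(* Length of the R-module N / M, for ideals M `<=` N: its submodules are the
   C / M for C an ideal between M and N. *)
Definition has_length N M (l : nat) : Prop :=
  is_max (strict_chain [set C | [/\ is_ideal C, M `<=` C & C `<=` N]]) l.

Definition regular_sequence (s : seq R) : Prop :=
  (forall i, (i < size s)%N -> forall y : R,
     ideal_gen [set` take i s] (s`_i * y) -> ideal_gen [set` take i s] y)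
  /\ ~ ideal_gen [set` s] 1.

Definition has_depth m (n : nat) : Prop :=
  is_max [set l | exists s : seq R,
            [/\ size s = l, [set` s] `<=` m & regular_sequence s]] n.

Definition cohen_macaulay_local m : Prop :=
  noetherian_local m /\ exists n, has_krull_dim n /\ has_depth m n.

Definition reduction I J : Prop :=
  [/\ is_ideal J, J `<=` I &
      exists n, ideal_exp I n.+1 = ideal_mul J (ideal_exp I n)].

Definition minimal_reduction I J : Prop :=
  reduction I J /\ forall J', reduction I J' -> J' `<=` J -> J' = J.

Definition stretched I H : Prop :=
  [/\ minimal_reduction I H,
      H `&` ideal_exp I 2 = ideal_mul H I &
      exists2 l, has_length (ideal_exp I 2)
                   (ideal_add (H `&` ideal_exp I 2) (ideal_exp I 3)) l
               & (l <= 1)%N].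

End Ideals.

(* pi exhibits the field k as the residue field R / m. *)
Definition residue_map (R : comNzRingType) (m : set R) (k : fieldType)
    (pi : {rmorphism R -> k}) : Prop :=
  range pi = setT /\ pi @^-1` [set 0] = m.

Definition same_characteristic (R S : nzRingType) : Prop :=
  forall n : nat, (n%:R = 0 :> R) <-> (n%:R = 0 :> S).

Section Zariski.
Variables (k : fieldType) (d s : nat).

(* The affine space k^(ds) is the space of d x s matrices. *)
Definition zariski_closed (Z : set 'M[k]_(d, s)) : Prop :=
  exists F : set {mpoly k[d * s]},
    Z = [set A | forall p, F p -> p.@[mxvec A 0] = 0].

Definition zariski_open (U : set 'M[k]_(d, s)) : Prop := zariski_closed (~` U).

Definition zariski_dense (U : set 'M[k]_(d, s)) : Prop :=
  forall V, zariski_open V -> V !=set0 -> U `&` V !=set0.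

End Zariski.

Definition for_general_minimal_reduction (R : comNzRingType) (k : fieldType)
    (pi : {rmorphism R -> k}) (d s : nat) (a : 'I_s -> R)
    (P : set R -> Prop) : Prop :=
  exists U : set 'M[k]_(d, s),
    [/\ zariski_open U, zariski_dense U &
        forall L : 'M[R]_(d, s), U (map_mx pi L) ->
          P (ideal_gen (range (fun i : 'I_d => \sum_(j < s) L i j * a j)))].

(* Main.v *)
Require Import Defs.
From HB Require Import structures.
From mathcomp Require Import all_boot all_order all_algebra.
From mathcomp Require Import mathcomp_extra boolp classical_sets functions cardinality.
From mathcomp Require Import mpoly.
From mathcomp Require Import ring.

(* A minimal reduction of I is generated by d parameters: more parameters would
   have more monomials than the growth of the colength allows, hence satisfy a
   form with a unit coefficient modulo higher order, and after a linear change all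
   of them but one would generate a smaller reduction.

   By the Cohen-Macaulay property a minimal reduction J = (x_1, ..., x_d) of I
   satisfies J `&` I^2 = J I iff x_1, ..., x_d are independent in I / I^2 over
   R / I, which can be tested on the socle of R / I, hence only depends on the
   residues of the coefficients of the x_i and is an open condition; being a
   reduction is open as well, by Nakayama. As for the length of I^2 / (J I + I^3):
   either I^2 = J I + m I^2 for some J, hence for a general J and then I^2 = J I;
   or J I + m I^2 has codimension one in I^2 / m I^2 at J = H and in general. In
   the latter case the linear relations modulo m I^2 among the generators x_i a_j
   of J I vary polynomially with J around H; they give elements of m I^2 whose
   values modulo m^2 I^2 only depend on residues, so that the inclusion
   m I^2 `<=` H I + I^3, i.e. the length being at most one, also holds for a
   general J. *)

Set Implicit Arguments.
Unset Strict Implicit.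
Unset Printing Implicit Defensive.

Import GRing.Theory.

Local Open Scope classical_set_scope.
Local Open Scope ring_scope.

(** * Ideals and Noetherian rings *)

Section IdealTheory.
Variable R : comNzRingType.
Implicit Types (I J K M N Q : set R) (x y z : R).

(** The delicate condition is that [J I + I^3] contains [m I^2]. Spanning and independence over [k]
    are lower bounds on ranks, hence open; but [J I] meets [m I^2] in elements produced by relations
    among the [x_i a_j] modulo [m I^2], and such relations need not move with [J] where the rank
    jumps. This is what the two cases on the length are for: if [J I + m I^2] never equals [I^2],
    the rank at [H] is already the largest possible. For matrices [A] of rank at most [r], the
    identity [det(PAQ) A = A Q adj(PAQ) P A] then expresses the relations polynomially in [A]. It
    holds at all residue matrices; since [k] is infinite, the same formula written with polynomials
    over [R] holds up to coefficients in [m].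

    The matrices have entries in [R] while openness is meant over [k]. Each condition is therefore
    encoded by polynomials over [R] whose values are only used modulo [m].

    Depth is used through two facts about [d] elements generating an ideal that contains a power of
    [m]: their syzygies have coefficients in that ideal, and no fewer elements generate such an
    ideal. *)

Lemma ideal0 I : is_ideal I -> I 0. Proof. by case. Qed.

Lemma idealD I x y : is_ideal I -> I x -> I y -> I (x + y).
Proof. by case=> _ + _; apply. Qed.

Lemma idealM I r x : is_ideal I -> I x -> I (r * x).
Proof. by case=> _ _; apply. Qed.

Lemma idealMr I r x : is_ideal I -> I x -> I (x * r).
Proof. by rewrite mulrC; apply: idealM. Qed.

Lemma idealN I x : is_ideal I -> I x -> I (- x).
Proof. by move=> iI Ix; rewrite -mulN1r; apply: idealM. Qed.

Lemma idealB I x y : is_ideal I -> I x -> I y -> I (x - y).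
Proof. by move=> iI Ix Iy; apply: idealD => //; apply: idealN. Qed.

Lemma ideal_sum I (T : Type) (r : seq T) (P : pred T) (F : T -> R) :
  is_ideal I -> (forall t, P t -> I (F t)) -> I (\sum_(t <- r | P t) F t).
Proof.
by move=> iI IF; apply: (big_ind I) => //;
  [exact: ideal0 | move=> x y; exact: idealD].
Qed.

Lemma idealBl I x y : is_ideal I -> I (x - y) -> I y -> I x.
Proof. by move=> iI Ixy Iy; rewrite -(subrK y x); apply: idealD. Qed.

Lemma idealBr I x y : is_ideal I -> I (x - y) -> I x -> I y.
Proof. by move=> iI Ixy Ix; rewrite -(subKr x y); apply: idealB. Qed.

Lemma ideal1 I : is_ideal I -> I 1 -> I = setT.
Proof.
by move=> iI I1; apply/seteqP; split=> // x _; rewrite -[x]mulr1; apply: idealM.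
Qed.

Lemma is_idealT : is_ideal [set: R]. Proof. by []. Qed.

Lemma is_idealI I J : is_ideal I -> is_ideal J -> is_ideal (I `&` J).
Proof.
move=> iI iJ; split; first by split; apply: ideal0.
- by move=> x y [? ?] [? ?]; split; apply: idealD.
- by move=> r x [? ?]; split; apply: idealM.
Qed.

Lemma is_ideal_gen (G : set R) : is_ideal (ideal_gen G).
Proof.
split; first by move=> A [iA _]; apply: ideal0.
- by move=> x y Gx Gy A [iA GA]; apply: idealD => //; [apply: Gx|apply: Gy].
- by move=> r x Gx A [iA GA]; apply: idealM => //; apply: Gx.
Qed.

Lemma ideal_gen_sub (G : set R) I : is_ideal I -> G `<=` I -> ideal_gen G `<=` I.
Proof. by move=> iI; exact: smallest_sub. Qed.

Lemma mem_ideal_gen (G : set R) x : G x -> ideal_gen G x.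
Proof. exact: sub_gen_smallest. Qed.

Lemma ideal_gen_rangeP (T : finType) (f : T -> R) y :
  ideal_gen (range f) y <-> exists c : T -> R, y = \sum_t c t * f t.
Proof.
split=> [|[c ->]]; last first.
  have iG := is_ideal_gen (range f); apply: (ideal_sum _ iG) => t _.
  by apply: (idealM _ iG); apply: (@mem_ideal_gen (range f)); exists t.
apply: (@ideal_gen_sub _ [set y | exists c : T -> R, y = \sum_t c t * f t]).
- split.
  + by exists (fun=> 0); rewrite big1 // => t _; rewrite mul0r.
  + move=> _ _ [c ->] [c' ->]; exists (fun t => c t + c' t).
    by rewrite -big_split /=; apply: eq_bigr => t _; rewrite mulrDl.
  + move=> r _ [c ->]; exists (fun t => r * c t).
    by rewrite big_distrr /=; apply: eq_bigr => t _; rewrite mulrA.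
- move=> _ [t _ <-]; exists (fun u => (u == t)%:R).
  rewrite (bigD1 t) //= eqxx mul1r big1 ?addr0 // => u /negPf ->.
  by rewrite mul0r.
Qed.

Lemma set_seq_range (s : seq R) : [set` s] = range (fun i : 'I_(size s) => s`_i).
Proof.
apply/seteqP; split=> x /=.
  by move=> xs; exists (Ordinal (etrans (index_mem x s) xs)) => //=; rewrite nth_index.
by case=> i _ <-; apply: mem_nth.
Qed.

Lemma range_enum_val (T : finType) (f : T -> R) :
  range f = range (fun i : 'I_#|T| => f (enum_val i)).
Proof.
apply/seteqP; split=> _ [t _ <-]; last by exists (enum_val t).
by exists (enum_rank t) => //; rewrite enum_rankK.
Qed.

Lemma is_ideal_add I J : is_ideal I -> is_ideal J -> is_ideal (ideal_add I J).
Proof.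
move=> iI iJ; split.
- by exists 0; [exact: ideal0|exists 0; [exact: ideal0|rewrite addr0]].
- move=> _ _ [x Ix [y Jy <-]] [x' Ix' [y' Jy' <-]].
  exists (x + x'); first exact: idealD.
  by exists (y + y'); [exact: idealD|rewrite addrACA].
- move=> r _ [x Ix [y Jy <-]]; exists (r * x); first exact: idealM.
  by exists (r * y); [exact: idealM|rewrite mulrDr].
Qed.

Lemma ideal_add_sub I J K : is_ideal K -> I `<=` K -> J `<=` K ->
  ideal_add I J `<=` K.
Proof.
by move=> iK IK JK _ [x Ix [y Jy <-]]; apply: idealD => //; [apply: IK|apply: JK].
Qed.

Lemma sub_ideal_addl I J : is_ideal J -> I `<=` ideal_add I J.
Proof. by move=> iJ x Ix; exists x => //; exists 0; rewrite ?addr0 //; exact: ideal0. Qed.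

Lemma sub_ideal_addr I J : is_ideal I -> J `<=` ideal_add I J.
Proof. by move=> iI x Jx; exists 0; [exact: ideal0|exists x; rewrite ?add0r]. Qed.

Lemma is_ideal_mul I J : is_ideal (ideal_mul I J).
Proof. exact: is_ideal_gen. Qed.

Lemma mem_ideal_mul I J x y : I x -> J y -> ideal_mul I J (x * y).
Proof. by move=> Ix Jy; apply: mem_ideal_gen; exists x => //; exists y. Qed.

Lemma ideal_mul_sub I J K : is_ideal K -> (forall x y, I x -> J y -> K (x * y)) ->
  ideal_mul I J `<=` K.
Proof.
move=> iK IJK; apply: ideal_gen_sub => // _ [x Ix [y Jy <-]]; exact: IJK.
Qed.

Lemma ideal_mulS I J I' J' : I `<=` I' -> J `<=` J' ->
  ideal_mul I J `<=` ideal_mul I' J'.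
Proof.
move=> II' JJ'; apply: ideal_mul_sub => [|x y Ix Jy]; first exact: is_ideal_mul.
by apply: mem_ideal_mul; [exact: II'|exact: JJ'].
Qed.

Lemma ideal_mulC I J : ideal_mul I J = ideal_mul J I.
Proof.
by apply/seteqP; split; apply: ideal_mul_sub => [|x y Ix Jy];
  (try exact: is_ideal_mul); rewrite mulrC; apply: mem_ideal_mul.
Qed.

Lemma ideal_mul_subr I J : is_ideal J -> ideal_mul I J `<=` J.
Proof. by move=> iJ; apply: ideal_mul_sub => // x y _; apply: idealM. Qed.

Lemma ideal_mul_subl I J : is_ideal I -> ideal_mul I J `<=` I.
Proof. by rewrite ideal_mulC; apply: ideal_mul_subr. Qed.

Lemma ideal_gen_mul_sub (G : set R) K x : is_ideal K ->
  (forall g, G g -> K (x * g)) -> forall y, ideal_gen G y -> K (x * y).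
Proof.
move=> iK GK; apply: (@ideal_gen_sub G [set y | K (x * y)]) => //; split=> /=.
- by rewrite mulr0; exact: ideal0.
- by move=> y z ? ?; rewrite mulrDr; exact: idealD.
- by move=> r y ?; rewrite mulrCA; exact: idealM.
Qed.

Lemma ideal_mul_gen (G G' : set R) :
  ideal_mul (ideal_gen G) (ideal_gen G') = ideal_gen [set x * y | x in G & y in G'].
Proof.
apply/seteqP; split; last first.
  apply: ideal_gen_sub; first exact: is_ideal_mul.
  by move=> _ [x Gx [y Gy <-]]; apply: mem_ideal_mul; apply: mem_ideal_gen.
have iK := is_ideal_gen [set x * y | x in G & y in G'].
apply: ideal_mul_sub => // x y Gx.
apply: ideal_gen_mul_sub => // g' Gg'; rewrite mulrC.
move: x Gx; apply: ideal_gen_mul_sub => // g Gg; rewrite mulrC.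
by apply: mem_ideal_gen; exists g => //; exists g'.
Qed.

Lemma ideal_mulA I J K : ideal_mul I (ideal_mul J K) = ideal_mul (ideal_mul I J) K.
Proof.
apply/seteqP; split.
  apply: ideal_mul_sub; first exact: is_ideal_mul.
  move=> x y Ix; apply: ideal_gen_mul_sub; first exact: is_ideal_mul.
  move=> _ [z Jz [t Kt <-]]; rewrite mulrA; apply: mem_ideal_mul => //.
  exact: mem_ideal_mul.
apply: ideal_mul_sub; first exact: is_ideal_mul.
move=> x y + Ky; rewrite mulrC; move: x.
apply: ideal_gen_mul_sub; first exact: is_ideal_mul.
move=> _ [z Iz [t Jt <-]]; rewrite mulrC -mulrA; apply: mem_ideal_mul => //.
exact: mem_ideal_mul.
Qed.

Lemma ideal_mul1 I : is_ideal I -> ideal_mul setT I = I.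
Proof.
move=> iI; apply/seteqP; split; first exact: ideal_mul_subr.
by move=> x Ix; rewrite -[x]mul1r; exact: mem_ideal_mul.
Qed.

Lemma is_ideal_exp I n : is_ideal (ideal_exp I n).
Proof. by case: n => [|n]; [exact: is_idealT|exact: is_ideal_mul]. Qed.

Lemma ideal_expS I n : ideal_exp I n.+1 = ideal_mul I (ideal_exp I n).
Proof. by []. Qed.

Lemma ideal_exp1 I : is_ideal I -> ideal_exp I 1 = I.
Proof. by move=> iI; rewrite ideal_expS ideal_mulC ideal_mul1. Qed.

Lemma ideal_exp2 I : is_ideal I -> ideal_exp I 2 = ideal_mul I I.
Proof. by move=> iI; rewrite ideal_expS ideal_exp1. Qed.

Lemma ideal_expD I n p : ideal_exp I (n + p) = ideal_mul (ideal_exp I n) (ideal_exp I p).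
Proof.
elim: n => [|n IHn]; first by rewrite ideal_mul1 //; exact: is_ideal_exp.
by rewrite addSn !ideal_expS IHn ideal_mulA.
Qed.

Lemma ideal_exp_decr I n p : (n <= p)%N -> ideal_exp I p `<=` ideal_exp I n.
Proof.
move=> /subnKC <-; rewrite ideal_expD; apply: ideal_mul_subl.
exact: is_ideal_exp.
Qed.

Lemma ideal_expSub I J n : I `<=` J -> ideal_exp I n `<=` ideal_exp J n.
Proof. by move=> IJ; elim: n => // n IHn; apply: ideal_mulS. Qed.

Lemma mem_ideal_exp I x n : I x -> ideal_exp I n (x ^+ n).
Proof.
by move=> Ix; elim: n => // n IHn; rewrite exprS; apply: mem_ideal_mul.
Qed.

(** A product is stripped of one factor [u] at a time, and [K] is replaced by its colon by [u]. This
    is why [K] is generalized in the double induction; no binomial expansion occurs. *)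
Lemma ideal_exp_add I J K n p : is_ideal K -> ideal_exp I n `<=` K ->
  ideal_exp J p `<=` K -> ideal_exp (ideal_add I J) (n + p) `<=` K.
Proof.
move=> iK; elim: n K p iK => [|n IHn] K p iK InK.
  by move=> _ x _; rewrite (ideal1 iK) //; exact: InK.
elim: p K iK InK => [|p IHp] K iK InK JpK.
  by move=> x _; rewrite (ideal1 iK) //; exact: JpK.
pose colon y := [set x | K (x * y)].
have icolon y : is_ideal (colon y).
  split; rewrite /colon /=; first by rewrite mul0r; exact: ideal0.
  - by move=> ? ? ? ?; rewrite mulrDl; exact: idealD.
  - by move=> ? ? ?; rewrite -mulrA; exact: idealM.
rewrite addSn ideal_expS; apply: ideal_mul_sub => // z x.
move=> [u Iu [v Jv <-]] Ex; rewrite mulrDl; apply: idealD => //.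
  rewrite mulrC; apply: (IHn (colon u) p.+1) => // y Ey.
    by apply: InK; rewrite mulrC; apply: mem_ideal_mul.
  by apply: (idealMr _ iK); exact: JpK.
rewrite mulrC; apply: (IHp (colon v)) => //; last by rewrite addSn -addnS.
  by move=> y Ey; apply: (idealMr _ iK); exact: InK.
by move=> y Ey; apply: JpK; rewrite mulrC; apply: mem_ideal_mul.
Qed.

Definition colon Q y : set R := [set x | Q (y * x)].

(** For an ideal [Q] this is [Q + R y]. Computations in [R / Q] are done with ideals above [Q], and
    successive quotients become [foldl adjoin]. *)
Definition adjoin Q y : set R := [set x | exists r, Q (x - r * y)].

Lemma is_ideal_colon Q y : is_ideal Q -> is_ideal (colon Q y).
Proof.
move=> iQ; split; rewrite /colon /=; first by rewrite mulr0; exact: ideal0.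
- by move=> ? ? ? ?; rewrite mulrDr; exact: idealD.
- by move=> ? ? ?; rewrite mulrCA; exact: idealM.
Qed.

Lemma sub_colon Q y : is_ideal Q -> Q `<=` colon Q y.
Proof. by move=> iQ x Qx; exact: idealM. Qed.

Lemma is_ideal_adjoin Q y : is_ideal Q -> is_ideal (adjoin Q y).
Proof.
move=> iQ; split; first by exists 0; rewrite mul0r subr0; exact: ideal0.
- move=> x z [r Qr] [t Qt]; exists (r + t).
  by rewrite mulrDl opprD addrACA; exact: idealD.
- by move=> t x [r Qr]; exists (t * r); rewrite -mulrA -mulrBr; exact: idealM.
Qed.

Lemma sub_adjoin Q y : Q `<=` adjoin Q y.
Proof. by move=> x Qx; exists 0; rewrite mul0r subr0. Qed.

Lemma mem_adjoin Q y : is_ideal Q -> adjoin Q y y.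
Proof. by move=> iQ; exists 1; rewrite mul1r subrr; exact: ideal0. Qed.

Lemma adjoin_sub Q y K : is_ideal K -> Q `<=` K -> K y -> adjoin Q y `<=` K.
Proof.
move=> iK QK Ky x [r /QK Kr]; apply: idealBl Kr _ => //; exact: idealM.
Qed.

Lemma adjoinC Q y z : is_ideal Q -> adjoin (adjoin Q y) z = adjoin (adjoin Q z) y.
Proof.
move=> iQ; apply/seteqP; split; apply: adjoin_sub;
  try (by do ?apply: is_ideal_adjoin);
  try (by apply: mem_adjoin; do ?apply: is_ideal_adjoin);
  try (by apply: sub_adjoin; apply: mem_adjoin);
  apply: adjoin_sub; try (by do ?apply: is_ideal_adjoin);
  try (by apply: mem_adjoin; do ?apply: is_ideal_adjoin);
  try (by apply: sub_adjoin; apply: mem_adjoin);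
  by move=> x Qx; apply: sub_adjoin; apply: sub_adjoin.
Qed.

Lemma is_ideal_foldl_adjoin Q s : is_ideal Q -> is_ideal (foldl adjoin Q s).
Proof. by elim: s Q => //= y s IHs Q iQ; apply: IHs; apply: is_ideal_adjoin. Qed.

Lemma sub_foldl_adjoin Q s : Q `<=` foldl adjoin Q s.
Proof.
elim: s Q => [|y s IHs] Q //=.
by apply: subset_trans (IHs _); exact: sub_adjoin.
Qed.

Lemma mem_foldl_adjoin Q s y : is_ideal Q -> y \in s -> foldl adjoin Q s y.
Proof.
elim: s Q => [|z s IHs] Q iQ //=; rewrite inE => /orP[/eqP->|ys].
  by apply: sub_foldl_adjoin; exact: mem_adjoin.
by apply: IHs => //; exact: is_ideal_adjoin.
Qed.

Lemma foldl_adjoin_sub Q s K : is_ideal K -> Q `<=` K -> (forall y, y \in s -> K y) ->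
  foldl adjoin Q s `<=` K.
Proof.
move=> iK; elim: s Q => [|y s IHs] Q QK sK //=; apply: IHs.
  by apply: adjoin_sub => //; apply: sK; rewrite mem_head.
by move=> z zs; apply: sK; rewrite inE zs orbT.
Qed.

Lemma is_ideal_zero : is_ideal [set (0 : R)].
Proof.
by split=> //= [x y -> ->|r x ->]; rewrite ?addr0 ?mulr0.
Qed.

Lemma foldl_adjoin0 s : foldl adjoin [set 0] s = ideal_gen [set` s].
Proof.
apply/seteqP; split.
  apply: foldl_adjoin_sub; first exact: is_ideal_gen.
    by move=> _ ->; apply: ideal0; exact: is_ideal_gen.
  by move=> y ys; exact: mem_ideal_gen.
apply: ideal_gen_sub; first by apply: is_ideal_foldl_adjoin; exact: is_ideal_zero.
by move=> y ys; apply: mem_foldl_adjoin ys; exact: is_ideal_zero.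
Qed.

End IdealTheory.

Section Noetherian.
Variable R : comNzRingType.
Hypothesis noethR : noetherian R.
Implicit Types (I J K M N Q : set R) (x y z : R).

Lemma noetherian_stationary (C : nat -> set R) : (forall n, is_ideal (C n)) ->
  (forall n, C n `<=` C n.+1) -> exists n0, forall n, C n `<=` C n0.
Proof.
move=> iC CS.
have Cle i j : (i <= j)%N -> C i `<=` C j.
  move=> /subnK <-; elim: (j - i)%N => // k IHk; rewrite addSn.
  exact: subset_trans IHk (CS _).
have iU : is_ideal [set x | exists n, C n x].
  split; first by exists 0%N; exact: ideal0.
  - move=> x y [i Cx] [j Cy]; exists (maxn i j); apply: idealD => //.
      exact: Cle (leq_maxl _ _) _ Cx.
    exact: Cle (leq_maxr _ _) _ Cy.
  - by move=> r x [i Cx]; exists i; exact: idealM.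
have [s Us] := noethR iU.
have [N sN] : exists n0, forall y, y \in s -> C n0 y.
  have : forall y, y \in s -> exists n, C n y.
    by move=> y ys; have : ideal_gen [set` s] y by [exact: mem_ideal_gen]; rewrite -Us.
  elim: {Us} s => [|y s IHs] sC; first by exists 0%N.
  have [|N sN] := IHs; first by move=> z zs; apply: sC; rewrite inE zs orbT.
  have [M yM] := sC y (mem_head _ _).
  exists (maxn N M) => z; rewrite inE => /orP[/eqP->|/sN zN].
    exact: Cle (leq_maxr _ _) _ yM.
  exact: Cle (leq_maxl _ _) _ zN.
exists N => n x Cx.
have : ideal_gen [set` s] x by rewrite -Us; exists n.
by apply: ideal_gen_sub => // y; exact: sN.
Qed.

Lemma noetherian_maximal (S : set (set R)) I : (forall J, S J -> is_ideal J) -> S I ->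
  exists M, [/\ S M, I `<=` M & forall J, S J -> M `<=` J -> J = M].
Proof.
move=> Sid SI; apply: contrapT => /forallNP noM.
have step (J : {J | S J /\ I `<=` J}) :
    {K : {J | S J /\ I `<=` J} | sval J `<` sval K}.
  case: J => J [SJ IJ] /=; apply: cid; have := noM J.
  apply: contra_notP => /forallNP noK; split=> // K SK JK.
  apply/seteqP; split=> //; apply: contrapT => KJ.
  by apply: (noK (exist _ K (conj SK (subset_trans IJ JK)))); split.
pose C0 : {J | S J /\ I `<=` J} := exist _ I (conj SI (@subset_refl _ I)).
pose C n := sval (iter n (fun X => sval (step X)) C0).
have CP n : C n `<` C n.+1 by rewrite /C iterS; exact: (svalP (step _)).
have [|n|N CN] := @noetherian_stationary C.
- by move=> n; have [SC _] := svalP (iter n (fun X => sval (step X)) C0); exact: Sid.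
- exact: (CP n).1.
- by case: (CP N) => _; apply; exact: CN.
Qed.

(** An ideal above [Q] that is maximal among those avoiding [S] is prime: if [x] and [y] lie outside
    [P], then [P + (x)] and [P + (y)] meet [S], and with [x * y] in [P] the product of the two
    elements found would lie in [P]. *)
Lemma exists_prime Q (S : set R) : is_ideal Q -> S 1 ->
  (forall x y, S x -> S y -> S (x * y)) -> (forall x, Q x -> ~ S x) ->
  exists P, [/\ prime_ideal P, Q `<=` P & forall x, P x -> ~ S x].
Proof.
move=> iQ S1 SM QS.
have [|P [[iP PS] QP Pmax]] := @noetherian_maximal
    [set J | is_ideal J /\ forall x, J x -> ~ S x] Q _ (conj iQ QS).
  by move=> J [].
have meetS x : ~ P x -> exists2 s, S s & adjoin P x s.
  move=> nPx; apply: contrapT => /forall2NP h; apply: nPx.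
  rewrite -(Pmax (adjoin P x)); first exact: mem_adjoin.
    split; first exact: is_ideal_adjoin.
    by move=> s Ps; case: (h s).
  exact: sub_adjoin.
exists P; split=> //; split=> //; first by move=> /PS.
move=> x y Pxy; have [|/meetS[s Ss [r Pr]]] := pselect (P x); first by left.
right; apply: contrapT => /meetS[t St [q Pq]]; apply: (PS (s * t)); last exact: SM.
have -> : s * t = (s - r * x) * t + r * x * (t - q * y) + r * q * (x * y) by ring.
by do 2?[apply: (idealD iP)]; [exact: idealMr|exact: idealM|exact: idealM].
Qed.

End Noetherian.

(** * Local rings *)

Section MoreIdeals.
Variable R : comNzRingType.

Lemma ideal_mul_rangeP (T : finType) (K : set R) (f : T -> R) y : is_ideal K ->
  ideal_mul K (ideal_gen (range f)) y <->
  exists c : T -> R, (forall t, K (c t)) /\ y = \sum_t c t * f t.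
Proof.
move=> iK; split=> [|[c [Kc ->]]]; last first.
  apply: (ideal_sum _ (is_ideal_mul _ _)) => t _.
  by apply: mem_ideal_mul => //; apply: (@mem_ideal_gen _ (range f)); exists t.
apply: (@ideal_mul_sub _ K (ideal_gen (range f))
  [set y | exists c : T -> R, (forall t, K (c t)) /\ y = \sum_t c t * f t]).
  split.
  - by exists (fun=> 0); split=> [_|]; [exact: ideal0|rewrite big1 // => t _; rewrite mul0r].
  - move=> _ _ [c [Kc ->]] [c' [Kc' ->]]; exists (fun t => c t + c' t).
    split=> [t|]; first exact: idealD.
    by rewrite -big_split /=; apply: eq_bigr => t _; rewrite mulrDl.
  - move=> r _ [c [Kc ->]]; exists (fun t => r * c t).
    split=> [t|]; first exact: idealM.
    by rewrite big_distrr /=; apply: eq_bigr => t _; rewrite mulrA.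
move=> x _ Kx /ideal_gen_rangeP[c ->]; exists (fun t => x * c t).
split=> [t|]; first exact: idealMr.
by rewrite big_distrr /=; apply: eq_bigr => t _; rewrite mulrA.
Qed.

End MoreIdeals.

Section LocalRing.
Variables (R : comNzRingType) (m : set R) (k : fieldType) (pi : {rmorphism R -> k}).
Hypotheses (locR : noetherian_local m) (piP : residue_map m pi).
Implicit Types (I J K M N Q : set R) (x y z : R).

Lemma noethR : noetherian R. Proof. by case: locR. Qed.

Lemma is_ideal_max : is_ideal m. Proof. by case: locR => _ []. Qed.

Lemma residue_eq0 x : m x <-> pi x = 0.
Proof. by case: piP => _ <-. Qed.

Lemma residue_lift : exists lift : k -> R, cancel lift pi.
Proof.
have /choice[lift liftK] : forall c, exists r, pi r = c; last by exists lift.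
by move=> c; case: piP => /seteqP[_ /(_ c I)[r _ <-]] _; exists r.
Qed.

Lemma proper_sub_max I : is_ideal I -> ~ I 1 -> I `<=` m.
Proof.
move=> iI I1; case: locR => nR maxm uniq.
have [|M [[iM M1] IM Mmax]] :=
  @noetherian_maximal _ nR [set J | is_ideal J /\ ~ J 1] I _ (conj iI I1).
  by move=> J [].
suff <- : M = m by [].
by apply: uniq; split=> // J iJ MJ J1; apply: Mmax.
Qed.

Lemma local_unit u : ~ m u -> exists v, v * u = 1.
Proof.
move=> mu; apply: contrapT => /forallNP nu; apply: mu.
apply: (@proper_sub_max (adjoin [set 0] u)).
- by apply: is_ideal_adjoin; exact: is_ideal_zero.
- by case=> r /= /eqP; rewrite subr_eq0 => /eqP /esym; exact: nu.
- by apply: mem_adjoin; exact: is_ideal_zero.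
Qed.

Lemma local_unitM N u x : is_ideal N -> ~ m u -> N (u * x) -> N x.
Proof.
by move=> iN /local_unit[v vu] Nux; rewrite -[x]mul1r -vu -mulrA; apply: idealM.
Qed.

(** Determinant trick: generators [x] of [M] satisfy [x = A x] modulo [N] with [A] over [m], so
    [det (1 - A)], whose residue is 1, multiplies [M] into [N]. *)
Lemma nakayama M N : is_ideal M -> is_ideal N ->
  M `<=` ideal_add N (ideal_mul m M) -> M `<=` N.
Proof.
move=> iM iN; have [s ->] := noethR iM; rewrite set_seq_range.
set x := fun i => _; move=> MN.
have /choice[A AP] (i : 'I_(size s)) : exists A : 'I_(size s) -> R,
    (forall j, m (A j)) /\ N (x i - \sum_j A j * x j).
  have [|y Ny [_ /(ideal_mul_rangeP _ _ is_ideal_max)[A [mA ->]] yE]] := MN (x i).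
    by apply: (@mem_ideal_gen _ (range x)); exists i.
  by exists A; split=> //; rewrite -yE addrK.
pose B : 'M_(size s) := 1%:M - \matrix_(i, j) A i j.
have mB : ~ m (\det B).
  move/residue_eq0; rewrite -det_map_mx.
  suff -> : map_mx pi B = 1%:M by rewrite det1; apply/eqP; exact: oner_neq0.
  apply/matrixP => i j; rewrite !mxE rmorphB rmorph_nat.
  by have [/(_ j)/residue_eq0 -> _] := AP i; rewrite subr0.
apply: ideal_gen_sub => // _ [i _ <-]; apply: (local_unitM iN mB).
pose X := \col_j x j.
have -> : \det B * x i = (\adj B *m (B *m X)) i 0.
  by rewrite mulmxA mul_adj_mx mul_scalar_mx !mxE.
rewrite mxE; apply: (ideal_sum _ iN) => j _; apply: idealM => //.
rewrite mulmxBl mul1mx !mxE; have [_] := AP j; congr (N (_ - _)).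
by apply: eq_bigr => l _; rewrite !mxE.
Qed.

End LocalRing.

(** * Depth *)

Lemma infinite_injection (T : Type) : infinite_set [set: T] ->
  exists f : nat -> T, injective f.
Proof.
move=> /infiniteP/card_leP[f]; exists (fun i => val (f (to_setT i))) => i j /val_inj fij.
have /(congr1 val) //: to_setT i = to_setT j.
by apply: (inj (f := f)) fij; rewrite ?inE.
Qed.

Section Depth.
Variables (R : comNzRingType) (m : set R) (k : fieldType) (pi : {rmorphism R -> k}).
Hypotheses (locR : noetherian_local m) (piP : residue_map m pi).
Hypothesis k_infinite : infinite_set [set: k].
Implicit Types (I J K M N Q : set R) (x y z : R).

Let iM : is_ideal m := is_ideal_max locR.

Lemma exists_residues : exists theta : nat -> R,
  forall i j, i != j -> ~ m (theta i - theta j).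
Proof.
have [f f_inj] := infinite_injection k_infinite.
have [lift liftK] := residue_lift piP.
exists (fun i => lift (f i)) => i j ij /(residue_eq0 piP)/eqP.
rewrite rmorphB !liftK subr_eq0 => /eqP/f_inj eqij.
by rewrite eqij eqxx in ij.
Qed.

Definition nzd Q z := forall s, Q (z * s) -> Q s.

(** No nonzero element of [R / Q] is killed by all of [g]: what is known before a suitable
    combination of [g] is chosen as a nonzerodivisor. *)
Definition nzd_seq Q (g : seq R) := forall s, (forall z, z \in g -> Q (z * s)) -> Q s.

(* The kernels of [u + theta_n v] on the elements of [R / Q] killed by [g] are
   independent, so only finitely many of them are nonzero. *)
Lemma eventually_nzd_seq Q u v g (theta : nat -> R) :
  (forall i j, i != j -> ~ m (theta i - theta j)) ->
  is_ideal Q -> nzd_seq Q (u :: v :: g) ->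
  exists n0, forall n, (n0 <= n)%N -> nzd_seq Q (u + theta n * v :: g).
Proof.
move=> thetaP iQ nzQ.
pose ker n := [set s | forall z, z \in u + theta n * v :: g -> Q (z * s)].
have iker n : is_ideal (ker n).
  split=> [z _|s t ks kt z zg|r s ks z zg]; first by rewrite mulr0; exact: ideal0.
    by rewrite mulrDr; apply: (idealD iQ); [exact: ks|exact: kt].
  by rewrite mulrCA; apply: (idealM _ iQ); exact: ks.
have indep n (t : nat -> R) : (forall i, ker i (t i)) -> Q (\sum_(i < n) t i) ->
    forall i, (i < n)%N -> Q (t i).
  elim: n t => // n IHn t kert; rewrite big_ord_recr /= => Qsum.
  have Qt i : (i < n)%N -> Q (t i).
    move=> ltin.
    have Qv : Q (v * t i).
      have nn : ~ m (theta n - theta i) by apply: thetaP; rewrite gtn_eqF.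
      apply: (local_unitM locR iQ nn); rewrite mulrA.
      (* Modulo [Q], the element [u + theta n * v] kills [t n] and acts on [t j] as
         [(theta n - theta j) * v]; multiplying by it removes the last term, as in a Vandermonde
         argument. *)
      apply: (IHn (fun i => (theta n - theta i) * v * t i)) => // [j|].
        by apply: (idealM _ (iker j)); exact: kert.
      have -> : \sum_(j < n) (theta n - theta j) * v * t j =
         \sum_(j < n) (u + theta n * v) * t j - \sum_(j < n) (u + theta j * v) * t j.
        by rewrite -sumrB; apply: eq_bigr => j _; ring.
      apply: (idealB iQ); last first.
        by apply: (ideal_sum _ iQ) => j _; apply: (kert j); rewrite mem_head.
      have : Q ((u + theta n * v) * t n) by apply: (kert n); rewrite mem_head.
      move=> Qn; rewrite -[X in Q X](addrK ((u + theta n * v) * t n)).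
      apply: (idealB iQ) => //.
      by have /(idealM (u + theta n * v) iQ) := Qsum; rewrite mulrDr big_distrr.
    apply: nzQ => z; rewrite !inE => /or3P[/eqP->|/eqP->//|zg]; last first.
      by apply: (kert i); rewrite inE zg orbT.
    have -> : u * t i = (u + theta i * v) * t i - theta i * (v * t i) by ring.
    apply: (idealB iQ); first by apply: (kert i); rewrite mem_head.
    exact: idealM.
  move=> i; rewrite ltnS leq_eqVlt => /orP[/eqP->|]; last exact: Qt.
  have -> : t n = \sum_(i < n) t i + t n - \sum_(i < n) t i by rewrite addrC addKr.
  by apply: (idealB iQ) => //; apply: (ideal_sum _ iQ) => j _; apply: Qt.
(* The sum of [Q] and the first [n] kernels. Once it is stationary, a later kernel lies in the sum
   of earlier ones, hence in [Q] by independence. *)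
pose C n := [set s | exists2 t : nat -> R, (forall i, ker i (t i))
                                          & Q (s - \sum_(i < n) t i)].
have [|n|n0 Cn0] := noetherian_stationary (noethR locR) (C := C).
- move=> n; split.
  + exists (fun=> 0) => [i|]; first exact: ideal0.
    by rewrite big1 // subrr; exact: ideal0.
  + move=> s s' [t kt Qs] [t' kt' Qs']; exists (fun i => t i + t' i).
      by move=> i; apply: (idealD (iker i)).
    by rewrite big_split opprD addrACA; exact: idealD.
  + move=> r s [t kt Qs]; exists (fun i => r * t i).
      by move=> i; apply: (idealM _ (iker i)).
    by rewrite -big_distrr -mulrBr; exact: idealM.
- move=> s [t kt Qs]; exists (fun i => if (i == n)%N then 0 else t i).
    by move=> i; case: ifP => // _; exact: ideal0.
  rewrite big_ord_recr /= eqxx addr0; congr (Q (_ - _)): Qs.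
  by apply: eq_bigr => i _; rewrite ltn_eqF.
exists n0 => n len0n s kers.
have [|t kt Qs] := Cn0 n.+1 s.
  exists (fun i => if (i == n)%N then s else 0).
    by move=> i; case: eqP => [->//|_]; exact: ideal0.
  rewrite big_ord_recr /= eqxx big1 ?add0r ?subrr; first exact: ideal0.
  by move=> i _; rewrite ltn_eqF.
pose t' i := if (i == n)%N then s else if (i < n0)%N then - t i else 0.
have := indep n.+1 t'; rewrite /t'; move=> /(_ _ _ n (ltnSn n)); rewrite eqxx; apply.
  move=> i; case: eqP => [->//|_]; case: ifP => _; last exact: ideal0.
  by apply: (idealN (iker i)); exact: kt.
rewrite big_ord_recr /= eqxx addrC; congr (Q (_ + _)): Qs.
rewrite -sumrN -(subnKC len0n) big_split_ord /= [X in _ = _ + X]big1 ?addr0; last first.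
  move=> i _; rewrite ltn_eqF ?ltn_add2l //.
  by rewrite ltnNge leq_addr.
apply: eq_bigr => i _; rewrite ltn_ord ltn_eqF //.
by apply: leq_trans (ltn_ord i) _; rewrite leq_addr.
Qed.

(** Plays the role of prime avoidance. The elements of [g] are absorbed one at a time, [u] and [v]
    being merged into [u + theta n * v] with [n] beyond the thresholds of all the [Qs l]. *)
Lemma exists_nzd q (Qs : 'I_q -> set R) u (g : seq R) :
  (forall l, is_ideal (Qs l)) -> (forall l, nzd_seq (Qs l) (u :: g)) ->
  exists2 w, forall l, nzd (Qs l) w & ideal_gen [set` g] (w - u).
Proof.
move=> iQs; have [theta thetaP] := exists_residues.
elim: g u => [|v g IHg] u nzQ.
  exists u => [l s us|]; last by rewrite subrr; apply: ideal0; exact: is_ideal_gen.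
  by apply: nzQ => z; rewrite inE => /eqP->.
have /choice[N NP] l := eventually_nzd_seq thetaP (iQs l) (nzQ l).
have [l|w nzw wu] := IHg (u + theta (\max_l N l)%N * v).
  by apply: NP; exact: leq_bigmax.
have iG := is_ideal_gen [set` v :: g]; exists w => //.
have -> : w - u = w - (u + theta (\max_l N l)%N * v) + theta (\max_l N l)%N * v by ring.
apply: (idealD iG).
  by apply: sub_smallest2r wu => // z; rewrite /= inE => ->; rewrite orbT.
by apply: (idealM _ iG); apply: mem_ideal_gen; rewrite /= mem_head.
Qed.

Lemma max_gen : exists g : seq R, m = ideal_gen [set` g].
Proof. exact: noethR locR m iM. Qed.

Lemma exists_nzd_max q (Qs : 'I_q -> set R) : (forall l, is_ideal (Qs l)) ->
  (forall l s, (forall z, m z -> Qs l (z * s)) -> Qs l s) ->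
  exists2 w, m w & forall l, nzd (Qs l) w.
Proof.
move=> iQs socQ; have [g mE] := max_gen.
have [l s gs|w nzw] := @exists_nzd _ Qs 0 g iQs.
  apply: socQ => z; rewrite mE mulrC; move: z.
  apply: ideal_gen_mul_sub => // z zg; rewrite mulrC.
  by apply: gs; rewrite inE zg orbT.
by rewrite subr0 -mE; exists w.
Qed.

Lemma nzd_adjoin_swap Q y z : is_ideal Q -> nzd Q y -> nzd (adjoin Q z) y ->
  nzd Q z -> nzd (adjoin Q y) z.
Proof.
move=> iQ nQy nQzy nQz s [r Qr].
have [|t Qt] := nQzy r.
  by exists s; rewrite mulrC (_ : r * y - s * z = - (z * s - r * y)); [exact: idealN|ring].
exists t; apply: nQz.
have -> : z * (s - t * y) = (z * s - r * y) + y * (r - t * z) by ring.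
by apply: (idealD iQ) => //; exact: idealM.
Qed.

(** The socles of [R / (Q + (y))] and [R / (Q + (z))] are both [Ext^1(k, R / Q)]. Concretely, if [s]
    is in the second and [y * s = v * z] modulo [Q], then [v] is in the first, and [s] vanishes when
    [v] does. *)
Lemma nzd_socle Q y z : is_ideal Q -> m y -> m z -> nzd Q y -> nzd Q z ->
  (exists2 y', m y' & nzd (adjoin Q y) y') ->
  forall s, (forall t, m t -> adjoin Q z (t * s)) -> adjoin Q z s.
Proof.
move=> iQ my mz nQy nQz [y' my' nQy'] s socs.
have [v Qv] := socs y my.
have [v' Qv'] : adjoin Q y v.
  apply: nQy'; have [c Qc] := socs y' my'.
  exists c; apply: nQz.
  have -> : z * (y' * v - c * y) = y * (y' * s - c * z) - y' * (y * s - v * z) by ring.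
  by apply: (idealB iQ); exact: idealM.
exists v'; apply: nQy.
have -> : y * (s - v' * z) = (y * s - v * z) + z * (v - v' * y) by ring.
by apply: (idealD iQ) => //; exact: idealM.
Qed.

(** A regular sequence is chosen from its first element, so that induction can replace [Q] by
    [adjoin Q y]. Properness is not built in: at the unit ideal it holds for every [n]. *)
Fixpoint depth_ge n Q : Prop :=
  if n is n'.+1 then exists y, [/\ m y, nzd Q y & depth_ge n' (adjoin Q y)] else True.

(** Some [w] is regular modulo [Q], [Q + (y)] and [Q + (z)] at once. The induction hypothesis
    applied to [Q + (y)] with [w], then to [Q + (w)] with [z], carries the depth from the given
    first element [y] to [z]; regular elements are swapped in between. *)
Lemma depth_ge_adjoin n Q z : is_ideal Q -> depth_ge n.+1 Q -> m z -> nzd Q z ->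
  depth_ge n (adjoin Q z).
Proof.
elim: n Q z => // n IHn Q z iQ [y [my nQy [y' [my' nQy' dQ]]]] mz nQz.
have iQy := is_ideal_adjoin y iQ; have iQz := is_ideal_adjoin z iQ.
pose Qs (l : 'I_3) := nth Q [:: adjoin Q y; adjoin Q z] l.
have [||w mw nw] := @exists_nzd_max 3 Qs.
- by move=> [[|[|[|//]]] ?].
- move=> [[|[|[|//]]] ?] s socs.
  + by apply: nQy'; exact: socs.
  + by apply: (@nzd_socle Q y z) socs => //; exists y'.
  + by apply: nQy; exact: socs.
have nwy : nzd (adjoin Q y) w := nw (@Ordinal 3 0 isT).
have nwz : nzd (adjoin Q z) w := nw (@Ordinal 3 1 isT).
have nwQ : nzd Q w := nw (@Ordinal 3 2 isT).
exists w; split=> //; rewrite adjoinC //.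
apply: (IHn) => //; [exact: is_ideal_adjoin| |exact: nzd_adjoin_swap].
exists y; split=> //; first exact: nzd_adjoin_swap.
by rewrite adjoinC //; apply: (IHn) => //; exists y'.
Qed.

End Depth.

Lemma ideal_gen_seqP (R : comNzRingType) (s : seq R) y :
  ideal_gen [set` s] y <-> exists c : nat -> R, y = \sum_(i < size s) c i * s`_i.
Proof.
rewrite set_seq_range ideal_gen_rangeP; split=> -[c ->]; last first.
  by exists (fun i : 'I_(size s) => c i).
exists (fun n => oapp c 0 (insub n)).
by apply: eq_bigr => i _; rewrite valK.
Qed.

(** * Systems of parameters and Koszul relations *)

Section SystemsOfParameters.
Variables (R : comNzRingType) (m : set R) (k : fieldType) (pi : {rmorphism R -> k}).
Hypotheses (locR : noetherian_local m) (piP : residue_map m pi).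
Hypothesis k_infinite : infinite_set [set: k].
Implicit Types (I J K M N Q : set R) (x y z : R).

Lemma nzdX Q y n s : nzd Q y -> Q (y ^+ n * s) -> Q s.
Proof. by move=> nQy; elim: n => [|n IHn]; rewrite ?mul1r // exprS -mulrA => /nQy. Qed.

Lemma foldl_adjoin_shift Q u w g : is_ideal Q -> ideal_gen [set` g] (w - u) ->
  foldl (@adjoin R) Q (u :: g) `<=` foldl (@adjoin R) Q (w :: g).
Proof.
move=> iQ gwu /=; have iQw := is_ideal_adjoin w iQ.
have iF := is_ideal_foldl_adjoin g iQw.
have gF y : y \in g -> foldl (@adjoin R) (adjoin Q w) g y by exact: mem_foldl_adjoin.
apply: foldl_adjoin_sub => //; apply: adjoin_sub => //.
  exact: subset_trans (@sub_adjoin _ Q w) (@sub_foldl_adjoin _ (adjoin Q w) g).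
rewrite -(subKr w u); apply: (idealB iF).
  by apply: (@sub_foldl_adjoin _ (adjoin Q w) g); exact: mem_adjoin.
exact: ideal_gen_sub gwu.
Qed.

(** An element killed by [u] and [g] modulo [Q] is killed by a power of [m], hence by a power of a
    nonzerodivisor, so it is in [Q]: the hypothesis of [exists_nzd] holds. *)
Lemma exists_nzd_parameter Q u g n c : is_ideal Q -> depth_ge m n.+1 Q ->
  ideal_exp m c `<=` foldl (@adjoin R) Q (u :: g) ->
  exists2 w, nzd Q w & ideal_gen [set` g] (w - u).
Proof.
move=> iQ [y [my nQy _]] mcQ.
have [//|_ s us|w nw] := @exists_nzd _ _ _ _ locR piP k_infinite 1 (fun=> Q) u g.
  apply: (@nzdX Q y c) => //; rewrite mulrC.
  suff : foldl (@adjoin R) Q (u :: g) `<=` colon Q s.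
    by apply; apply: mcQ; exact: mem_ideal_exp.
  apply: foldl_adjoin_sub => [|x Qx|x xg]; first exact: is_ideal_colon.
    exact: idealM.
  by rewrite /colon /= mulrC; exact: us.
by exists w => //; exact: (nw ord0).
Qed.

Lemma max_gen_shift u w g : (forall z, z \in u :: g -> m z) ->
  ideal_gen [set` g] (w - u) -> m w.
Proof.
move=> mh gwu; have iM := is_ideal_max locR; apply: (idealBl iM _ (mh u _)).
  apply: ideal_gen_sub gwu => // z zg; apply: mh; rewrite inE; apply/orP; right.
  exact: zg.
exact: mem_head.
Qed.

(** The first parameter is changed into a nonzerodivisor by adding a combination of the others, then
    divided out. When no parameter is left, a power of a nonzerodivisor would lie in [Q] and force
    [Q 1]. *)
Lemma depth_ge_size n Q h c : is_ideal Q -> ~ Q 1 -> (forall z, z \in h -> m z) ->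
  ideal_exp m c `<=` foldl (@adjoin R) Q h -> depth_ge m n Q -> (n <= size h)%N.
Proof.
have iM := is_ideal_max locR.
elim: h n Q => [|u g IHg] [|n] Q iQ Q1 mh mcQ //.
  move=> [y [my nQy _]]; exfalso; apply: Q1; apply: (@nzdX Q y c) => //.
  by rewrite mulr1; apply: mcQ; exact: mem_ideal_exp.
move=> dQ; have [w nQw gwu] := exists_nzd_parameter iQ dQ mcQ.
have mw := max_gen_shift mh gwu; have iQw := is_ideal_adjoin w iQ.
apply: (IHg _ (adjoin Q w)) => //.
- suff Qm : adjoin Q w `<=` m by case: locR => _ [_ m1 _] _ /Qm.
  by apply: adjoin_sub => //; exact: proper_sub_max locR _ iQ Q1.
- by move=> z zg; apply: mh; rewrite inE zg orbT.
- by apply: subset_trans mcQ _; exact: foldl_adjoin_shift.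
- exact: (depth_ge_adjoin locR piP k_infinite iQ dQ mw nQw).
Qed.

(* The Koszul complex on a system of parameters is exact in degree one; the
   quadratic identity on [A], which holds for alternating matrices, is all that
   the induction needs. *)
Lemma parameters_relation Q h c (r : nat -> R) : is_ideal Q ->
  (forall z, z \in h -> m z) -> ideal_exp m c `<=` foldl (@adjoin R) Q h ->
  depth_ge m (size h) Q -> Q (\sum_(i < size h) r i * h`_i) ->
  exists (A : nat -> nat -> R) (q : nat -> R),
    (forall i, (i < size h)%N ->
       Q (q i) /\ r i = \sum_(j < size h) A i j * h`_j + q i) /\
    \sum_(i < size h) \sum_(j < size h) A i j * (h`_i * h`_j) = 0.
Proof.
elim: h Q r => [|u g IHg] Q r iQ mh mcQ dQ.
  by move=> _; exists (fun _ _ => 0), (fun=> 0); split=> //; rewrite big_ord0.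
have [w nQw gwu] := exists_nzd_parameter iQ dQ mcQ.
have mw := max_gen_shift mh gwu; have iQw := is_ideal_adjoin w iQ.
have [c' wuE] := (ideal_gen_seqP _ _).1 gwu.
have wE : w = u + \sum_(j < size g) c' j * g`_j by rewrite -wuE addrC subrK.
rewrite /= big_ord_recl /= => Qr.
have rhoE : \sum_(j < size g) (r j.+1 - r 0%N * c' j) * g`_j + r 0%N * w =
            r 0%N * u + \sum_(j < size g) r j.+1 * g`_j.
  rewrite wE mulrDr [r 0%N * \sum__ _]big_distrr /= addrCA -big_split /=.
  by congr (_ + _); apply: eq_bigr => j _; ring.
(* In terms of [w] and [g], the relation has coefficient [r 0] at [w] and [r j.+1 - r 0 * c' j] at
   [g_j]; modulo [Q + (w)] it becomes a relation among the [g_j] alone. *)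
have [||||A [q [Aq A0]]] := IHg (adjoin Q w) (fun j => r j.+1 - r 0%N * c' j) iQw.
- by move=> z zg; apply: mh; rewrite inE zg orbT.
- by apply: subset_trans mcQ _; exact: foldl_adjoin_shift.
- exact: (depth_ge_adjoin locR piP k_infinite iQ dQ mw nQw).
- by exists (- r 0%N); rewrite mulNr opprK rhoE.
have /choice[a aP] j : exists t, (j < size g)%N -> Q (q j - t * w).
  have [/Aq[[t Qt] _]|//] := boolP (j < size g)%N; first by exists t.
  by exists 0.
pose Sa := \sum_(j < size g) a j * g`_j; pose Sc := \sum_(j < size g) c' j * g`_j.
have sumq : \sum_(j < size g) (q j - a j * w) * g`_j =
    \sum_(j < size g) (r j.+1 - r 0%N * c' j) * g`_j - w * Sa.
  rewrite -[X in _ = X - _]subr0 -[X in _ = _ - X - _]A0 -sumrB big_distrr -sumrB /=.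
  apply: eq_bigr => j _; have [_ ->] := Aq j (ltn_ord j).
  rewrite [(\sum_(_ < _) _ + _) * _]mulrDl big_distrl /=
    (eq_bigr (fun l : 'I__ => A j l * (g`_j * g`_l))).
    by ring.
  by move=> l _; ring.
(* The quadratic identity [A0] removes the contribution of [A], leaving [w * (r 0 + Sa)] in [Q];
   then [w] cancels. *)
have Q0 : Q (r 0%N + Sa).
  apply: nQw.
  have -> : w * (r 0%N + Sa) = (r 0%N * u + \sum_(j < size g) r j.+1 * g`_j) -
                            \sum_(j < size g) (q j - a j * w) * g`_j.
    by rewrite sumq -rhoE; ring.
  apply: (idealB iQ) => //; apply: (ideal_sum _ iQ) => j _.
  by apply: (idealMr _ iQ); apply: aP.
(* The border [-a], [a] is the Koszul relation between [w] and the [g_j]; the alternating correction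
   [a i * c' j - c' i * a j] comes from rewriting [w] as [u + Sc]. *)
pose A' i j := match i, j with
  | O, O => 0 | O, S j => - a j | S i, O => a i
  | S i, S j => A i j + (a i * c' j - c' i * a j) end.
pose q' i := if i is i.+1 then q i - a i * w + c' i * (r 0%N + Sa) else r 0%N + Sa.
exists A', q'; split=> [[_|i]|].
- split=> //=; rewrite big_ord_recl /= mul0r add0r.
  by rewrite (eq_bigr _ (fun _ _ => mulNr _ _)) sumrN addrC addrK.
- rewrite ltnS => lti; split=> /=.
    by apply: (idealD iQ); [exact: aP|exact: idealM].
  have [_ rhoi] := Aq i lti.
  rewrite big_ord_recl /= (eq_bigr (fun j : 'I_(size g) => A i j * g`_j +
     (a i * (c' j * g`_j) - c' i * (a j * g`_j)))); last by move=> j _; ring.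
  rewrite big_split sumrB -!big_distrr /= -/Sa -/Sc wE -/Sc.
  by rewrite -[LHS](subrK (r 0%N * c' i)) rhoi; ring.
- rewrite /= big_ord_recl /= big_ord_recl /= mul0r add0r.
  rewrite (eq_bigr (fun j : 'I_(size g) => - (u * (a j * g`_j)))); last first.
    by move=> j _; ring.
  rewrite [X in _ + X](eq_bigr (fun i : 'I_(size g) =>
    \sum_(j < size g) A i j * (g`_i * g`_j) +
    (u * (a i * g`_i) + ((a i * g`_i) * Sc - (c' i * g`_i) * Sa)))).
    rewrite !big_split /= A0 add0r sumrN addKr sumrN -!big_distrl /=.
    by rewrite -/Sa -/Sc mulrC subrr.
  move=> i _; rewrite big_ord_recl /= addrCA; congr (_ + _); first by ring.
  rewrite [_ * Sc]big_distrr [_ * Sa]big_distrr -sumrB -big_split /=.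
  by apply: eq_bigr => j _; ring.
Qed.

End SystemsOfParameters.

(** * Cohen-Macaulay rings *)

Section CohenMacaulay.
Variables (R : comNzRingType) (m : set R).
Hypothesis locR : noetherian_local m.
Implicit Types (I J K M N P Q : set R) (x y z : R).

Lemma ideal_exp_principal_sub I x n : is_ideal I -> I (x ^+ n) ->
  ideal_exp (ideal_gen [set x]) n `<=` I.
Proof.
move=> iI Ixn; have : ideal_gen [set x ^+ n] `<=` I.
  by apply: ideal_gen_sub => // _ ->.
apply: subset_trans; elim: n {I iI Ixn} => [|n IHn].
  by rewrite expr0 (@ideal1 _ (ideal_gen [set 1])) //; [exact: is_ideal_gen|exact: mem_ideal_gen].
rewrite ideal_expS; apply: subset_trans (ideal_mulS (@subset_refl _ _) IHn) _.
rewrite ideal_mul_gen; apply: ideal_gen_sub; first exact: is_ideal_gen.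
by move=> _ [_ -> [_ -> <-]]; rewrite -exprS; exact: mem_ideal_gen.
Qed.

Lemma exists_ideal_exp_sub I J : is_ideal I -> is_ideal J ->
  (forall x, J x -> exists n, I (x ^+ n)) -> exists n, ideal_exp J n `<=` I.
Proof.
move=> iI iJ; have [s ->] := noethR locR iJ => nilJ.
have {nilJ} : forall x, x \in s -> exists n, I (x ^+ n).
  by move=> x xs; apply: nilJ; exact: mem_ideal_gen.
elim: s => [|x s IHs] nils.
  exists 1%N; rewrite ideal_exp1; last exact: is_ideal_gen.
  exact: ideal_gen_sub.
have [|p Ip] := IHs; first by move=> y ys; apply: nils; rewrite inE ys orbT.
have [n Ixn] := nils x (mem_head _ _).
exists (n + p)%N.
apply: subset_trans (ideal_exp_add iI (ideal_exp_principal_sub iI Ixn) Ip).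
have iA := is_ideal_add (is_ideal_gen [set x]) (is_ideal_gen [set` s]).
apply: ideal_expSub; apply: ideal_gen_sub => // y; rewrite /= inE => /orP[/eqP->|ys].
  by apply: sub_ideal_addl; [exact: is_ideal_gen|exact: mem_ideal_gen].
by apply: sub_ideal_addr; [exact: is_ideal_gen|exact: mem_ideal_gen].
Qed.

(* A nonzerodivisor modulo Q lies in no minimal prime of Q. *)
Lemma exists_smaller_prime Q y P : is_ideal Q -> nzd Q y -> prime_ideal P ->
  Q `<=` P -> P y -> exists P', [/\ prime_ideal P', Q `<=` P' & P' `<` P].
Proof.
move=> iQ nQy primeP QP Py; have [iP P1 PM] := primeP.
(* The products of a power of [y] with an element outside [P] avoid [Q] because [y] is regular. A
   prime avoiding them lies in [P] (exponent 0) and does not contain [y] (cofactor 1). *)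
have [||x Qx [t [nPt [n xE]]]|P' [primeP' QP' P'S]] :=
  @exists_prime _ (noethR locR) Q [set x | exists t, ~ P t /\ exists n, x = y ^+ n * t] iQ.
- by exists 1; split=> //; exists 0%N; rewrite mulr1.
- move=> _ _ [t [nPt [n ->]]] [t' [nPt' [n' ->]]]; exists (t * t'); split.
    by case/PM.
  by exists (n + n')%N; rewrite exprD; ring.
- by apply: nPt; apply: QP; apply: (@nzdX R Q y n) => //; rewrite -xE.
exists P'; split=> //; split.
  move=> x P'x; apply: contrapT => nPx; apply: (P'S _ P'x).
  by exists x; split=> //; exists 0%N; rewrite mul1r.
move=> /(_ _ Py) P'y; apply: (P'S _ P'y).
by exists 1; split=> //; exists 1%N; rewrite mulr1.
Qed.

Definition nzd_chain Q (s : seq R) :=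
  forall i, (i < size s)%N -> nzd (foldl (@adjoin R) Q (take i s)) s`_i.

(** The elements are dropped from the last one on: each is regular modulo the preceding ones, so the
    current prime contains a strictly smaller prime above those. *)
Lemma prime_chain Q s P : is_ideal Q -> nzd_chain Q s -> prime_ideal P ->
  foldl (@adjoin R) Q s `<=` P ->
  exists C : nat -> set R, [/\ forall i, (i <= size s)%N -> prime_ideal (C i),
    forall i, (i < size s)%N -> C i `<` C i.+1 & C (size s) = P].
Proof.
move=> iQ; elim/last_ind: s P => [|s y IHs] P nzs primeP QP.
  by exists (fun=> P).
rewrite foldl_rcons in QP; have iQs := is_ideal_foldl_adjoin s iQ.
have nQy : nzd (foldl (@adjoin R) Q s) y.
  have := nzs (size s); rewrite size_rcons -cats1 take_size_cat // nth_cat ltnn subnn.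
  by apply.
have [||P' [primeP' QP' P'P]] := exists_smaller_prime iQs nQy primeP.
- by apply: subset_trans QP; exact: sub_adjoin.
- by apply: QP; exact: mem_adjoin.
have [|C [Cprime Clt CE]] := IHs P' _ primeP' QP'.
  move=> i lti; have := nzs i; rewrite size_rcons ltnS nth_rcons lti.
  by rewrite -cats1 takel_cat; [apply; exact: ltnW|exact: ltnW].
exists (fun i => if (i <= size s)%N then C i else P); rewrite size_rcons.
split=> [i|i|]; last by rewrite ltnn.
- by case: (leqP i (size s)) => // lei _; exact: Cprime.
- by rewrite ltnS; case: ltngtP => // [lti|->] _; [exact: Clt|rewrite CE].
Qed.

Lemma nzd_chain_depth s Q : (forall y, y \in s -> m y) -> nzd_chain Q s ->
  depth_ge m (size s) Q.
Proof.
elim: s Q => //= y s IHs Q ms nzs; exists y; split.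
- by apply: ms; rewrite mem_head.
- exact: (nzs 0%N).
apply: IHs => [z zs|i lti]; first by apply: ms; rewrite inE zs orbT.
exact: (nzs i.+1).
Qed.

(** A regular sequence of length [d] is a system of parameters: otherwise some prime above it misses
    an element of [m], and the chain of [d] steps ending at that prime extends to [m], exceeding the
    dimension. *)
Lemma cohen_macaulay_parameters d : cohen_macaulay_local m -> has_krull_dim R d ->
  depth_ge m d [set 0] /\ exists s : seq R, [/\ size s = d, [set` s] `<=` m
    & exists c, ideal_exp m c `<=` ideal_gen [set` s]].
Proof.
move=> [_ [n [dimn [[s [sizes ms regs]] _]]]] dimd.
have nE : n = d.
  by apply/eqP; rewrite eqn_leq; apply/andP; split; [apply: dimd.2|apply: dimn.2];
    [exact: dimn.1|exact: dimd.1].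
rewrite {}nE {n dimn} in sizes.
have i0 : is_ideal [set (0 : R)] := is_ideal_zero R.
have nzs : nzd_chain [set 0] s.
  by move=> i lti y; rewrite foldl_adjoin0; exact: regs.1.
split; first by rewrite -sizes; exact: nzd_chain_depth.
exists s; split=> //; apply: exists_ideal_exp_sub; [exact: is_ideal_gen|exact: is_ideal_max|].
move=> x mx; apply: contrapT => /forallNP nilx.
have [||z sz [n zE]|P [primeP sP Px]] :=
    @exists_prime _ (noethR locR) _ [set y | exists n, y = x ^+ n] (is_ideal_gen [set` s]).
- by exists 0%N.
- by move=> _ _ [n ->] [p ->]; exists (n + p)%N; rewrite exprD.
- by apply: (nilx n); rewrite -zE.
have [|C [Cprime Clt CE]] := prime_chain i0 nzs primeP; first by rewrite foldl_adjoin0.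
have Pm : P `<` m.
  case: (primeP) => iP P1 _; split; first exact: proper_sub_max locR _ iP P1.
  by move=> /(_ _ mx) P_x; apply: (Px _ P_x); exists 1%N.
suff : (d.+1 <= d)%N by rewrite ltnn.
apply: dimd.2; exists (fun i => if (i <= d)%N then C i else m); split=> i.
  case: (leqP i d) => [lei _|_ _]; first by apply: Cprime; rewrite sizes.
  have [iM m1 mmax] : maximal_ideal m by case: locR.
  split=> // y z myz; have [|my] := pselect (m y); first by left.
  right; have [v vy] := local_unit locR my.
  by rewrite -[z]mul1r -vy -mulrA; apply: (idealM _ iM).
rewrite ltnS; case: ltngtP => // [lti|->] _; first by apply: Clt; rewrite sizes.
by rewrite -sizes CE.
Qed.

End CohenMacaulay.

(** * Nonvanishing of polynomials over an infinite field *)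

Section PolynomialValues.
Variable k : fieldType.
Hypothesis k_infinite : infinite_set [set: k].

Lemma digits_inj b n (f g : nat -> nat) : (forall i, f i < b)%N -> (forall i, g i < b)%N ->
  (\sum_(i < n) f i * b ^ i = \sum_(i < n) g i * b ^ i)%N ->
  forall i, (i < n)%N -> f i = g i.
Proof.
elim: n f g => // n IHn f g fb gb.
have b_gt0 : (0 < b)%N by apply: leq_ltn_trans (fb 0%N).
have shift (F : nat -> nat) : (\sum_(i < n.+1) F i * b ^ i =
    (\sum_(i < n) F i.+1 * b ^ i) * b + F 0)%N.
  rewrite big_ord_recl expn0 muln1 addnC big_distrl; congr (_ + _)%N.
  by apply: eq_bigr => i _; rewrite lift0 expnSr mulnA.
rewrite !shift => E.
have E0 : f 0%N = g 0%N by have := congr1 (modn^~ b) E; rewrite /= !modnMDl !modn_small.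
move: E; rewrite E0 => /addIn/eqP; rewrite eqn_pmul2r // => /eqP E [//|i lti].
exact: (IHn (f \o S) (g \o S) (fun i => fb i.+1) (fun i => gb i.+1) E).
Qed.

Lemma mpoly_nonroot n (p : {mpoly k[n]}) : p != 0 -> exists v, p.@[v] != 0.
Proof.
move=> p0; pose b := msize p.
have msup m : m \in msupp p -> forall i, (m i < b)%N.
  move=> mp i; apply: leq_ltn_trans (msize_mdeg_lt mp).
  by rewrite mdegE (bigD1 i) //= leq_addr.
(* Kronecker substitution: X_i is replaced with t ^ (b ^ i). *)
pose code (m : 'X_{1..n}) := (\sum_(i < n) m i * b ^ i)%N.
have code_inj : {in msupp p &, injective code}.
  move=> m m' mp mp' E; apply/mnmP => i.
  pose f (m : 'X_{1..n}) j := oapp m 0%N (insub j).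
  have fE (u : 'X_{1..n}) (j : 'I_n) : f u j = u j by rewrite /f valK.
  rewrite -!fE; apply: (@digits_inj b n) => // [j|j|].
  - by rewrite /f; case: insub => /= [l|]; [exact: msup|apply: leq_ltn_trans (msup m mp i)].
  - by rewrite /f; case: insub => /= [l|]; [exact: msup|apply: leq_ltn_trans (msup m mp i)].
  - by under eq_bigr do rewrite fE; under [RHS]eq_bigr do rewrite fE.
pose q := \sum_(m <- msupp p) p@_m *: 'X^(code m).
have q0 : q != 0.
  have [m mp] : exists m, m \in msupp p.
    by case: (msupp p) (msupp_eq0 p) p0 => [<-|m s]; [|exists m; rewrite mem_head].
  apply/eqP => /(congr1 (fun r : {poly k} => r`_(code m))).
  rewrite coef0 coef_sum (bigD1_seq m) //= ?msupp_uniq //.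
  rewrite coefZ coefXn eqxx mulr1 big_seq_cond big1 ?addr0.
    by apply/eqP; rewrite -mcoeff_msupp.
  move=> m' /andP[mp' ne]; rewrite coefZ coefXn; case: eqP => [E|]; last by rewrite mulr0.
  by rewrite (code_inj m m') ?eqxx // in ne.
have [f f_inj] := infinite_injection k_infinite.
have [t qt] : exists t, ~~ root q t.
  apply: contrapT => /forallNP allq.
  have := max_poly_roots q0 (rs := map f (iota 0 (size q))).
  rewrite size_map size_iota ltnn (map_inj_uniq f_inj) iota_uniq => allroot.
  suff /allroot/(_ isT) : all (root q) (map f (iota 0 (size q))) by [].
  by apply/allP => t _; apply/negPn/negP; exact: allq.
exists (fun i => t ^+ (b ^ i)); rewrite mevalE.
move: qt; rewrite /root /q horner_sum; congr (_ != _).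
apply: eq_bigr => m _; rewrite hornerZ hornerXn /code expr_sum; congr (_ * _).
by apply: eq_bigr => i _; rewrite -exprM mulnC.
Qed.

End PolynomialValues.

(** * Analytic spread *)

Section Colength.
Variables (R : comNzRingType) (m : set R).
Hypothesis locR : noetherian_local m.
Implicit Types (I J K M N P Q a b : set R) (x y z : R).

(* The length of [R / a] is at most [B]. *)
Definition colength_le a (B : nat) := forall C : nat -> set R,
  (forall i, is_ideal (C i)) -> a `<=` C 0%N -> (forall i, C i `<=` C i.+1) ->
  forall l, (\sum_(i < l) `[< C i.+1 <> C i >] <= B)%N.

Lemma colength_le_top a B : a 1 -> colength_le a B.
Proof.
move=> a1 C iC aC CS l; rewrite big1 // => i _; apply/eqP; rewrite eqb0.
have CT j : C j 1 by elim: j => [|j]; [exact: aC|exact: CS].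
by apply/asboolPn; rewrite notK (ideal1 (iC i.+1) (CT _)) (ideal1 (iC i) (CT _)).
Qed.

(** Multiplication by [y] gives the exact sequence [0 -> R/(a:y) -> R/a -> R/(a+(y)) -> 0]: a strict
    step of a chain stays strict after [adjoin] or after [colon]. *)
Lemma colength_le_split a y B1 B2 : is_ideal a -> colength_le (adjoin a y) B1 ->
  colength_le (colon a y) B2 -> colength_le a (B1 + B2).
Proof.
move=> ia aB1 aB2 C iC aC CS l.
have aS := aB1 (fun i => adjoin (C i) y) (fun i => is_ideal_adjoin y (iC i)).
have cS := aB2 (fun i => colon (C i) y) (fun i => is_ideal_colon y (iC i)).
apply: leq_trans (leq_add (aS _ _ l) (cS _ _ l)).
- rewrite -big_split; apply: leq_sum => i _.
  case: asboolP => [neC|//]; do 2 case: asboolP => //=.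
  move=> /contrapT eqc /contrapT eqa; exfalso; apply: neC.
  apply/seteqP; split=> // x Cx.
  have [r Cr] : adjoin (C i) y x by rewrite -eqa; exact: sub_adjoin.
  apply: (idealBl (iC i) Cr); rewrite mulrC.
  suff : colon (C i) y r by [].
  rewrite -eqc /colon /= mulrC -(subKr x (r * y)).
  by apply: (idealB (iC _)) => //; exact: CS.
- by move=> x [r ar]; exists r; exact: aC.
- by move=> i x [r Cr]; exists r; exact: CS.
- by move=> x; exact: aC.
- by move=> i x; exact: CS.
Qed.

(** [R / a] is filtered by the powers of [y], with factors of the form [R / (a' + (y))] for colon
    ideals [a'] above [a]; hence a bound uniform in [a']. *)
Lemma colength_le_pow a y n B : is_ideal a -> a (y ^+ n) ->
  (forall a', is_ideal a' -> a `<=` a' -> colength_le (adjoin a' y) B) ->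
  colength_le a (n * B).
Proof.
elim: n a => [|n IHn] a ia an aB; first exact: colength_le_top.
rewrite mulSn; apply: (colength_le_split ia); first exact: aB.
apply: IHn; first exact: is_ideal_colon.
  by rewrite /colon /= -exprS.
move=> a' ia' aa'; apply: aB => //; apply: subset_trans aa'.
exact: sub_colon.
Qed.

(** The factor [n ^ size s] is crude, but with [d] parameters it bounds the colength of powers of an
    ideal by a polynomial of degree [d] in the exponent, enough for the comparison with numbers of
    monomials. *)
Lemma colength_le_seq a (s : seq R) n B : is_ideal a -> (forall y, y \in s -> a (y ^+ n)) ->
  (forall b, is_ideal b -> a `<=` b -> (forall y, y \in s -> b y) -> colength_le b B) ->
  colength_le a (n ^ size s * B).
Proof.
elim: s a => [|y s IHs] a ia an aB; first by rewrite mul1n; exact: aB.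
rewrite expnS -mulnA; apply: (@colength_le_pow _ y) => //.
  by apply: an; rewrite mem_head.
move=> a' ia' aa'; have ia'y := is_ideal_adjoin y ia'.
apply: IHs => // [z zs|b ib a'b sb].
  by apply: sub_adjoin; apply: aa'; apply: an; rewrite inE zs orbT.
apply: aB => // [z az|z].
  by apply: a'b; apply: sub_adjoin; exact: aa'.
by rewrite inE => /orP[/eqP->|/sb//]; apply: a'b; exact: mem_adjoin.
Qed.

Lemma colength_le_max a : m `<=` a -> colength_le a 1.
Proof.
move=> ma C iC aC CS l.
have mC j : m `<=` C j.
  by elim: j => [|j IHj]; [exact: subset_trans aC|exact: subset_trans (CS j)].
have [_ [iM m1 mmax] _] := locR.
have CE j : ~ C j 1 -> C j = m by exact: mmax.
suff : (\sum_(i < l) `[< C i.+1 <> C i >] <= `[< C l 1%R >])%N.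
  by move/leq_trans; apply; case: `[< _ >].
elim: l => [|l IHl]; first by rewrite big_ord0.
rewrite big_ord_recr /=; move: IHl.
have [Cl1|nCl1] := asboolP (C l 1).
  have CS1 : C l.+1 1 by exact: CS.
  rewrite (asboolT CS1) (ideal1 (iC l) Cl1) (ideal1 (iC l.+1) CS1) asboolF; last by apply.
  by rewrite addn0.
rewrite leqn0 => /eqP->; rewrite add0n (CE l nCl1).
have [_|nCS1] := asboolP (C l.+1 1); first exact: leq_b1.
by rewrite (CE _ nCS1) asboolF //; apply.
Qed.

Lemma colength_le_parameters (s : seq R) c : ideal_exp m c `<=` ideal_gen [set` s] ->
  exists l, forall b, is_ideal b -> (forall y, y \in s -> b y) -> colength_le b l.
Proof.
move=> mcs; have [g mE] := max_gen locR.
exists (c ^ size g * 1)%N => b ib sb; apply: colength_le_seq => // [y yg|b' ib' _ gb'].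
  have : ideal_gen [set` s] (y ^+ c).
    by apply: mcs; apply: mem_ideal_exp; rewrite mE; exact: mem_ideal_gen.
  exact: ideal_gen_sub.
by apply: colength_le_max; rewrite mE; exact: ideal_gen_sub.
Qed.

Lemma colength_le_dependent a B (g : seq R) : is_ideal a -> colength_le a B ->
  (B < size g)%N -> exists2 i, (i < size g)%N & foldl (@adjoin R) a (take i g) g`_i.
Proof.
move=> ia aB ltBg; apply: contrapT => /forall2NP indep.
pose C i := foldl (@adjoin R) a (take i g).
have iC i : is_ideal (C i) by exact: is_ideal_foldl_adjoin.
have CS i : (i < size g)%N -> C i.+1 = adjoin (C i) g`_i.
  by move=> lti; rewrite /C (take_nth 0) // foldl_rcons.
suff : (\sum_(i < size g) `[< C i.+1 <> C i >] <= B)%N.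
  rewrite (eq_bigr (fun _ => 1%N)) ?sum1_card ?card_ord => [|i _].
    by move/(leq_trans ltBg); rewrite ltnn.
  rewrite asboolT // CS // => eqa.
  have [/(_ (ltn_ord i))//|] := indep i; apply; rewrite -/(C i) -eqa.
  exact: mem_adjoin.
apply: aB => // [|i]; first by rewrite /C take0.
have [lti|leig] := ltnP i (size g); first by rewrite CS //; exact: sub_adjoin.
by rewrite /C !take_oversize //; exact: leqW.
Qed.

End Colength.

(** * Reductions and the Rees algebra *)

Section Reductions.
Variable R : comNzRingType.
Implicit Types (I J K M N P Q H a b : set R) (x y z : R).

Lemma reductionP I J n : is_ideal I -> is_ideal J -> J `<=` I ->
  ideal_exp I n.+1 `<=` ideal_mul J (ideal_exp I n) -> reduction I J.
Proof.
move=> iI iJ JI IJ; split=> //; exists n; apply/seteqP; split=> //.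
by rewrite ideal_expS; exact: ideal_mulS.
Qed.

Lemma ideal_exp_reduction I H n p : ideal_exp I n.+1 = ideal_mul H (ideal_exp I n) ->
  ideal_exp I (n + p) = ideal_mul (ideal_exp H p) (ideal_exp I n).
Proof.
move=> HI; elim: p => [|p IHp]; first by rewrite addn0 ideal_mul1 //; exact: is_ideal_exp.
rewrite addnS ideal_expS IHp ideal_mulA [ideal_mul I _]ideal_mulC -ideal_mulA.
by rewrite -ideal_expS HI ideal_mulA [ideal_mul _ H]ideal_mulC.
Qed.

Lemma reduction_trans I H J : is_ideal I -> reduction I H -> reduction H J -> reduction I J.
Proof.
move=> iI [iH HI [n IH]] [iJ JH [p HJ]].
apply: (@reductionP _ _ (n + p)) => //; first exact: subset_trans JH HI.
by rewrite -addnS !(ideal_exp_reduction _ IH) HJ ideal_mulA.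
Qed.

Lemma reduction_nilpotent I J x n : reduction I J -> I (x ^+ n) -> exists p, J (x ^+ p).
Proof.
move=> [iJ _ [p IJ]] Ixn; exists (n * p.+1)%N; rewrite exprM.
by apply: (ideal_mul_subl iJ (J := ideal_exp I p)); rewrite -IJ; exact: mem_ideal_exp.
Qed.

Lemma ideal_exp_prod H (T : Type) (r : seq T) (n : T -> nat) (x : T -> R) :
  (forall t, ideal_exp H (n t) (x t)) ->
  ideal_exp H (\sum_(t <- r) n t) (\prod_(t <- r) x t).
Proof.
move=> Hx; apply: (big_rec2 (fun n x => ideal_exp H n x)) => // t p y _ Hy.
by rewrite ideal_expD; exact: mem_ideal_mul.
Qed.

(* The degree n part of J times the Rees algebra of H. *)
Definition rees_ideal J H n := if n is n'.+1 then ideal_mul J (ideal_exp H n') else [set 0].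

Lemma is_ideal_rees J H n : is_ideal (rees_ideal J H n).
Proof. by case: n => [|n]; [exact: is_ideal_zero|exact: is_ideal_mul]. Qed.

Lemma rees_ideal_mul J H n p x y : rees_ideal J H n x -> ideal_exp H p y ->
  rees_ideal J H (n + p) (x * y).
Proof.
case: n => [|n] Jx Hy.
  by rewrite (Jx : x = 0) mul0r; exact: ideal0 (is_ideal_rees _ _ _).
by rewrite /rees_ideal addSn ideal_expD ideal_mulA; exact: mem_ideal_mul.
Qed.

(** Congruence modulo [J] in the Rees algebra of [H] is compatible with products; degrees are
    tracked by hand. *)
Lemma rees_ideal_prod J H (T : Type) (r : seq T) (n : T -> nat) (x y : T -> R) :
  (forall t, ideal_exp H (n t) (x t)) -> (forall t, ideal_exp H (n t) (y t)) ->
  (forall t, rees_ideal J H (n t) (x t - y t)) ->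
  rees_ideal J H (\sum_(t <- r) n t) (\prod_(t <- r) x t - \prod_(t <- r) y t).
Proof.
move=> Hx Hy Jxy; elim: r => [|t r IHr]; first by rewrite !big_nil subrr.
rewrite !big_cons.
have -> : x t * \prod_(j <- r) x j - y t * \prod_(j <- r) y j =
   (\prod_(j <- r) x j - \prod_(j <- r) y j) * x t
   + (x t - y t) * \prod_(j <- r) y j by ring.
apply: (idealD (is_ideal_rees _ _ _)).
  by rewrite addnC; exact: rees_ideal_mul.
by apply: rees_ideal_mul => //; exact: ideal_exp_prod.
Qed.

Lemma rees_idealX J H x y n : H x -> H y -> J (x - y) ->
  rees_ideal J H n (x ^+ n - y ^+ n).
Proof.
move=> Hx Hy Jxy; elim: n => [|n IHn]; first by rewrite subrr.
rewrite !exprS.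
have -> : x * x ^+ n - y * y ^+ n = (x ^+ n - y ^+ n) * x + (x - y) * y ^+ n by ring.
apply: (idealD (is_ideal_rees _ _ _)); last by apply: mem_ideal_mul => //; exact: mem_ideal_exp.
by rewrite -addn1; apply: rees_ideal_mul => //; rewrite -[x]expr1; exact: mem_ideal_exp.
Qed.

Lemma ideal_exp_adjoin J H t n : H t -> J `<=` H -> H `<=` adjoin J t ->
  ideal_exp H n `<=` adjoin (rees_ideal J H n) (t ^+ n).
Proof.
move=> Ht JH HJt; elim: n => [|n IHn].
  by move=> x _; exists x; rewrite mulr1 subrr.
have iA := is_ideal_adjoin (t ^+ n.+1) (is_ideal_rees J H n.+1).
rewrite ideal_expS; apply: ideal_mul_sub => // x y Hx /IHn[s Jy].
have [r Jx] := HJt _ Hx; exists (r * s).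
have -> : x * y - r * s * t ^+ n.+1 =
   (x - r * t) * (s * t ^+ n) + (y - s * t ^+ n) * x by rewrite exprS; ring.
apply: (idealD (is_ideal_rees _ _ _)).
  apply: mem_ideal_mul => //; apply: (idealM _ (is_ideal_exp _ _)).
  exact: mem_ideal_exp.
rewrite -addn1; apply: rees_ideal_mul => //.
by rewrite -[x]expr1; exact: mem_ideal_exp.
Qed.

End Reductions.

Section AnalyticSpread.
Variables (R : comNzRingType) (m : set R) (k : fieldType) (pi : {rmorphism R -> k}).
Hypotheses (locR : noetherian_local m) (piP : residue_map m pi).
Hypothesis k_infinite : infinite_set [set: k].
Implicit Types (I J K M N P Q H a b : set R) (x y z : R).

Lemma nakayama_reduction I J n : is_ideal I -> is_ideal J -> J `<=` I ->
  ideal_exp I n.+1 `<=` ideal_add (ideal_mul J (ideal_exp I n)) (ideal_mul m (ideal_exp I n.+1)) ->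
  reduction I J.
Proof.
move=> iI iJ JI IJ; apply: (reductionP (n := n)) => //.
exact: (nakayama locR piP (is_ideal_exp _ _) (is_ideal_mul _ _) IJ).
Qed.

Section Monomials.
Variables (e n : nat) (h : 'I_e -> R).
Let T := {ffun 'I_e -> 'I_n.+1}.
Definition mono (f : 'I_e -> R) (u : T) := \prod_i f i ^+ u i.
Definition mono_deg (u : T) := (\sum_i u i)%N.

(* There are more monomials of degree at most n in each variable than the length
   of R / H^(en+1): one of them depends on the others of at least its degree. *)
Lemma exists_form H B : is_ideal H -> (forall i, H (h i)) ->
  colength_le (ideal_exp H (e * n).+1) B -> (B < n.+1 ^ e)%N ->
  exists (u : T) (r : T -> R), r u = 1 /\
    ideal_exp H (mono_deg u).+1 (\sum_(v | mono_deg v == mono_deg u) r v * mono h v).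
Proof.
move=> iH Hh HB ltB.
(* Monomials are listed by decreasing degree, so those preceding [u] have degree at least that of
   [u]. *)
pose geq_deg := [rel v w : T | (mono_deg w <= mono_deg v)%N].
pose s := sort geq_deg (enum T).
have sizes : size s = (n.+1 ^ e)%N.
  by rewrite size_sort -cardE card_ffun !card_ord.
have degs : sorted geq_deg s.
  by apply: sort_sorted => v w; rewrite /geq_deg /=; exact: leq_total.
have geq_trans : transitive geq_deg by move=> v w x /= wv /leq_trans; apply.
have Hmono v : ideal_exp H (mono_deg v) (mono h v).
  by apply: ideal_exp_prod => i; exact: mem_ideal_exp.
have mono_le v : (mono_deg v <= e * n)%N.
  rewrite -[e]card_ord -sum_nat_const; apply: leq_sum => i _.
  by rewrite -ltnS.
have iHS := is_ideal_exp H (e * n).+1.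
have [|i] := colength_le_dependent iHS HB (g := map (mono h) s).
  by rewrite size_map sizes.
rewrite size_map => lti.
pose v0 : T := [ffun=> ord0]; pose u := nth v0 s i.
rewrite -map_take (nth_map v0) // -/u.
(* Elements that, modulo [H] to the power [mono_deg u + 1], are combinations of the monomials of the
   same degree other than [u]. This ideal contains all the monomials preceding [u]. *)
pose K := [set x | exists r : T -> R, r u = 0 /\ ideal_exp H (mono_deg u).+1
    (x - \sum_(v | mono_deg v == mono_deg u) r v * mono h v)].
have iE := is_ideal_exp H (mono_deg u).+1.
have iK : is_ideal K.
  split.
  - exists (fun=> 0); split=> //; rewrite big1 ?subrr; first exact: (ideal0 iE).
    by move=> v _; rewrite mul0r.
  - move=> x y [r [ru Hx]] [t [tu Hy]]; exists (fun v => r v + t v).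
    split; first by rewrite ru tu addr0.
    under eq_bigr do rewrite mulrDl.
    by rewrite big_split opprD addrACA; exact: (idealD iE).
  - move=> t x [r [ru Hx]]; exists (fun v => t * r v); split; first by rewrite ru mulr0.
    under eq_bigr do rewrite -mulrA.
    by rewrite -big_distrr -mulrBr; exact: (idealM _ iE).
have EK : ideal_exp H (mono_deg u).+1 `<=` K.
  move=> x Ex; exists (fun=> 0); split=> //; rewrite big1 ?subr0 // => v _.
  by rewrite mul0r.
suff sK : foldl (@adjoin R) (ideal_exp H (e * n).+1) (map (mono h) (take i s)) `<=` K.
  move=> /sK[r [ru Hr]]; exists u, (fun v => if v == u then 1 else - r v).
  split; first by rewrite eqxx.
  move: Hr; rewrite (bigD1 u) //= ru mul0r add0r => Hr.
  rewrite (bigD1 u) //= eqxx mul1r (eq_bigr (fun v => - (r v * mono h v))).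
    by rewrite sumrN.
  by move=> v /andP[_ /negPf->]; rewrite mulNr.
apply: foldl_adjoin_sub => //.
  by apply: subset_trans EK; apply: ideal_exp_decr; rewrite ltnS.
move=> _ /mapP[v vs ->].
have uniqs : uniq s by rewrite sort_uniq enum_uniq.
have neuv : v != u.
  apply/eqP => vu; move: uniqs; rewrite -(cat_take_drop i s) cat_uniq => /and3P[_ /hasPn + _].
  by move=> /(_ u); rewrite -vu vs (drop_nth v0) // -/u vu mem_head => /(_ isT).
have [/eqP degvu|degvu] := boolP (mono_deg v == mono_deg u).
  exists (fun w => (w == v)%:R); split; first by rewrite eq_sym (negPf neuv).
  rewrite (bigD1 v) ?degvu //= eqxx mul1r big1 ?addr0 ?subrr; first exact: (ideal0 iE).
  by move=> w /andP[_ /negPf->]; rewrite mul0r.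
apply: EK; apply: ideal_exp_decr (Hmono v); rewrite ltn_neqAle eq_sym degvu /=.
move: degs; rewrite -(cat_take_drop i s) (drop_nth v0) // -/u.
rewrite sorted_pairwise // pairwise_cat => /and3P[/allrelP + _ _].
by apply => //; rewrite mem_head.
Qed.

End Monomials.

End AnalyticSpread.

(** * The number of generators of a minimal reduction *)

Section MinimalReductions.
Variables (R : comNzRingType) (m : set R) (k : fieldType) (pi : {rmorphism R -> k}).
Hypotheses (locR : noetherian_local m) (piP : residue_map m pi).
Hypothesis k_infinite : infinite_set [set: k].
Implicit Types (I J K M N P Q H a b : set R) (x y z : R).

(** With [t] equal to [h i0] divided by the unit [c i0], subtracting [c i * t] from [h i] kills the
    generator of index [i0]: modulo the new ideal, the [h i] specialize to the point [c] times
    [t]. *)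
Lemma change_generators e (h : 'I_e.+1 -> R) (c : 'I_e.+1 -> R) i0 : ~ m (c i0) ->
  exists (h' : 'I_e -> R) t, [/\ ideal_gen (range h') `<=` ideal_gen (range h),
    ideal_gen (range h) t & forall i, ideal_gen (range h') (h i - c i * t)].
Proof.
move=> mc; have [v vc] := local_unit locR mc.
pose t := v * h i0; exists (fun j => h (lift i0 j) - c (lift i0 j) * t), t.
have iH := is_ideal_gen (range h).
have hH i : ideal_gen (range h) (h i) by apply: (@mem_ideal_gen _ (range h)); exists i.
have Ht : ideal_gen (range h) t by apply: (idealM _ iH).
set h' := fun j => _; split=> //.
  apply: ideal_gen_sub => // _ [j _ <-]; apply: (idealB iH) => //.
  exact: (idealM _ iH).
move=> i; have [j ->|->] := unliftP i0 i.
  by apply: (@mem_ideal_gen _ (range h')); exists j.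
rewrite /t mulrA [c i0 * v]mulrC vc mul1r subrr.
exact: (ideal0 (is_ideal_gen _)).
Qed.

Lemma sub_adjoin_generators e e' (h : 'I_e.+1 -> R) (h' : 'I_e' -> R) c t :
  (forall i, ideal_gen (range h') (h i - c i * t)) ->
  ideal_gen (range h) `<=` adjoin (ideal_gen (range h')) t.
Proof.
move=> hh'; have iA := is_ideal_adjoin t (is_ideal_gen (range h')).
by apply: ideal_gen_sub => // _ [i _ <-]; exists (c i).
Qed.

(** At a point [c] where the residue form is nonzero, the form becomes [phi * t ^+ N] modulo [J],
    with [phi] a unit. It lies in the next power of [H], so [H^N] is contained in
    [J H^(N-1) + m H^N], and Nakayama concludes. *)
Lemma reduction_of_form e n (h : 'I_e.+1 -> R) (u : {ffun 'I_e.+1 -> 'I_n.+1})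
    (r : {ffun 'I_e.+1 -> 'I_n.+1} -> R) :
  ideal_gen (range h) `<=` m -> r u = 1 ->
  ideal_exp (ideal_gen (range h)) (mono_deg u).+1
    (\sum_(v | mono_deg v == mono_deg u) r v * mono h v) ->
  exists h' : 'I_e -> R, reduction (ideal_gen (range h)) (ideal_gen (range h')).
Proof.
set H := ideal_gen (range h); set N := mono_deg u => Hm ru Hform.
have iH : is_ideal H := is_ideal_gen _.
pose mn (v : {ffun 'I_e.+1 -> 'I_n.+1}) : 'X_{1..e.+1} := [multinom (v i : nat) | i < e.+1].
have mn_inj : injective mn.
  by move=> v w /mnmP vw; apply/ffunP => i; apply/val_inj; have := vw i; rewrite !mnmE.
pose p : {mpoly k[e.+1]} := \sum_(v | mono_deg v == N) pi (r v) *: 'X_[mn v].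
have p0 : p != 0.
  apply/eqP => /(congr1 (mcoeff (mn u))); rewrite mcoeff0 raddf_sum /=.
  rewrite (bigD1 u) //= mcoeffZ mcoeffX eqxx mulr1 ru rmorph1 big1 ?addr0.
    by apply/eqP; exact: oner_neq0.
  by move=> v /andP[_ vu]; rewrite mcoeffZ mcoeffX inj_eq // (negPf vu) mulr0.
(* The extra factor ['X_ord0] makes the first coordinate of the point nonzero, as the pivot for
   [change_generators]. *)
have [cb] : exists v, (p * 'X_ord0).@[v] != 0.
  apply: mpoly_nonroot => //; rewrite mulf_neq0 //.
  apply/eqP => /(congr1 (mcoeff U_(ord0))); rewrite mcoeffX eqxx mcoeff0.
  by apply/eqP; exact: oner_neq0.
rewrite mevalM mevalXU mulf_eq0 negb_or => /andP[pc0 c0].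
have [lft liftK] := residue_lift piP.
pose c i := lft (cb i).
have mc0 : ~ m (c ord0) by move/(residue_eq0 piP); rewrite liftK; exact/eqP.
pose phi := \sum_(v | mono_deg v == N) r v * mono c v.
have mphi : ~ m phi.
  move/(residue_eq0 piP); apply/eqP; move: pc0; congr (_ != _).
  rewrite /p /phi !raddf_sum; apply: eq_bigr => v _ /=.
  rewrite mevalZ mevalX rmorphM rmorph_prod; congr (_ * _).
  by apply: eq_bigr => i _; rewrite rmorphXn liftK mnmE.
have [h' [t [h'H Ht hh']]] := change_generators h mc0.
set J := ideal_gen (range h') in h'H hh'.
have hH i : H (h i) by apply: (@mem_ideal_gen _ (range h)); exists i.
have phit : rees_ideal J H N
    ((\sum_(v | mono_deg v == N) r v * mono h v) - phi * t ^+ N).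
  rewrite big_distrl -sumrB /=.
  apply: (ideal_sum _ (is_ideal_rees _ _ _)) => v /eqP degv.
  rewrite -mulrA -mulrBr; apply: (idealM _ (is_ideal_rees _ _ _)).
  have -> : mono c v * t ^+ N = mono (fun i => c i * t) v.
    rewrite /mono -degv expr_sum -big_split /=.
    by apply: eq_bigr => i _; rewrite exprMn.
  rewrite -degv; have Hct i : H (c i * t) by apply: (idealM _ iH).
  apply: rees_ideal_prod => i; try exact: mem_ideal_exp.
  exact: rees_idealX.
have HN : ideal_exp H N `<=` adjoin (rees_ideal J H N) (t ^+ N).
  by apply: ideal_exp_adjoin => //; exact: sub_adjoin_generators hh'.
(* In degree 0 the form would be the unit [phi] itself, lying in [H] and so in [m]. *)
exists h'; have [N0|/prednK NE] := posnP N.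
  exfalso; apply: mphi; apply: Hm; rewrite -(ideal_exp1 iH).
  move: phit Hform; rewrite N0 mulr1 => phit; congr (ideal_exp H 1 _).
  by apply/eqP; rewrite -subr_eq0; apply/eqP.
move: Hform phit HN; rewrite -NE /=; set N' := N.-1 => Hform phit HN.
have iA := is_ideal_add (is_ideal_mul J (ideal_exp H N')) (is_ideal_mul m (ideal_exp H N'.+1)).
apply: (nakayama_reduction locR piP (n := N')) => //; first exact: is_ideal_gen.
move=> x /HN[s Jx]; apply: (idealBl iA).
  exact: sub_ideal_addl (is_ideal_mul _ _) _ Jx.
apply: (idealM _ iA); apply: (local_unitM locR iA mphi); apply: (idealBr iA).
  exact: sub_ideal_addl (is_ideal_mul _ _) _ phit.
apply: sub_ideal_addr; first exact: is_ideal_mul.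
exact: ideal_mulS Hform.
Qed.

(** Descent on the number of generators: with more than [d] of them, the monomials outnumber the
    colength, one generator can be spared in a smaller reduction, and minimality identifies that
    reduction with [H]. *)
Lemma minimal_reduction_generators d (s : seq R) c I H : size s = d ->
  ideal_exp m c `<=` ideal_gen [set` s] -> [set` s] `<=` m ->
  is_ideal I -> I `<=` m -> (forall x, m x -> exists n, I (x ^+ n)) ->
  minimal_reduction I H -> exists h : 'I_d -> R, H = ideal_gen (range h).
Proof.
move=> sizes mcs sm iI Im nilI [redH minH]; have [iH HI _] := redH.
have [g] := noethR locR iH; rewrite set_seq_range => HE.
have [q qH] : exists q, ideal_exp m q `<=` H.
  apply: (exists_ideal_exp_sub locR) => //; first exact: is_ideal_max.
  by move=> x /nilI[n Ixn]; exact: reduction_nilpotent redH Ixn.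
have [l lP] := colength_le_parameters locR mcs.
elim: (size g) (fun i : 'I_(size g) => g`_i) HE => [|e IHe] h HE.
  exists (fun=> 0); rewrite HE; apply/seteqP; split.
    by apply: ideal_gen_sub; [exact: is_ideal_gen|move=> x [i]; case: i].
  apply: ideal_gen_sub; first exact: is_ideal_gen.
  by move=> _ [_ _ <-]; exact: (ideal0 (is_ideal_gen _)).
have [led|ltd] := leqP e.+1 d.
  (* Fewer than [d] generators are padded with zeros. *)
  exists (fun i => oapp h 0 (insub (val i))); rewrite HE.
  have iG := is_ideal_gen (range (fun i : 'I_d => oapp h 0 (insub (val i)))).
  apply/seteqP; split.
    apply: (ideal_gen_sub iG) => _ [i _ <-]; apply: mem_ideal_gen.
    by exists (widen_ord led i) => //=; rewrite valK.
  apply: ideal_gen_sub => [|_ [i _ <-]]; first exact: is_ideal_gen.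
  case: insub => [j|] /=; last exact: (ideal0 (is_ideal_gen _)).
  by apply: (@mem_ideal_gen _ (range h)); exists j.
(* Chosen so that the colength bound [(q * (e.+1 * n).+1) ^ d * l] is at most [n * n.+1 ^ d], which
   is less than [n.+1 ^ e.+1] since [d < e.+1]. *)
pose n := ((q * e.+1) ^ d * l)%N.
have colH : colength_le (ideal_exp H (e.+1 * n).+1) ((q * (e.+1 * n).+1) ^ d * l).
  rewrite -sizes; apply: colength_le_seq; first exact: is_ideal_exp.
    move=> y ys; rewrite exprM; apply: mem_ideal_exp; apply: qH.
    by apply: mem_ideal_exp; exact: sm.
  by move=> a ia _ sa; exact: lP.
have hH i : H (h i) by rewrite HE; apply: (@mem_ideal_gen _ (range h)); exists i.
have [|u [r [ru Hr]]] := exists_form iH hH colH.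
  apply: (@leq_ltn_trans (n * n.+1 ^ d)).
    rewrite /n mulnAC -expnMn leq_mul2r; apply/orP; right.
    have [->|d_gt0] := posnP d; first by rewrite !expn0.
    by rewrite leq_exp2r // -mulnA leq_mul2l [(e.+1 * n.+1)%N]mulnS addSn ltnS leq_addl orbT.
  apply: (@leq_trans (n.+1 ^ d.+1)); last by rewrite leq_pexp2l.
  by rewrite expnS ltn_pmul2r // expn_gt0.
have [h' redh'] : exists h' : 'I_e -> R, reduction H (ideal_gen (range h')).
  rewrite HE; apply: reduction_of_form ru _; first by rewrite -HE; exact: subset_trans Im.
  by rewrite -HE.
apply: (IHe h'); apply/esym/minH; last by case: redh'.
exact: reduction_trans redh'.
Qed.

End MinimalReductions.

(** * Reductions generated by parameters *)

Section ParameterReductions.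
Variables (R : comNzRingType) (m : set R) (k : fieldType) (pi : {rmorphism R -> k}).
Hypotheses (locR : noetherian_local m) (piP : residue_map m pi).
Hypothesis k_infinite : infinite_set [set: k].
Implicit Types (I J K M N P Q H : set R) (x y z : R).

Lemma set_codom (T : finType) (f : T -> R) : [set` codom f] = range f.
Proof.
apply/seteqP; split=> [_ /codomP[t ->]|_ [t _ <-]]; first by exists t.
exact: codom_f.
Qed.

Lemma reduction_primary I J : (forall x, m x -> exists n, I (x ^+ n)) ->
  reduction I J -> exists c, ideal_exp m c `<=` J.
Proof.
move=> nilI redJ; have [iJ _ _] := redJ.
apply: (exists_ideal_exp_sub locR) => //; first exact: is_ideal_max.
by move=> x /nilI[n Ixn]; exact: reduction_nilpotent redJ Ixn.
Qed.

(** Let [Z] express generators of a smaller reduction [J'] through [x]. If [Z] has full column rank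
    over [k], Nakayama gives [J' = J]. Otherwise a kernel vector gives a change of generators after
    which [J'] lies in [J'' + m J], with [J''] generated by one element less; [J''] is then a
    reduction with too few generators for the depth. *)
Lemma parameters_minimal_reduction d (x : 'I_d -> R) I : depth_ge m d [set 0] ->
  is_ideal I -> I `<=` m -> (forall y, m y -> exists n, I (y ^+ n)) ->
  reduction I (ideal_gen (range x)) -> minimal_reduction I (ideal_gen (range x)).
Proof.
move=> depth_d iI Im nilI; set J := ideal_gen (range x) => redJ.
split=> // J' redJ' J'J; apply/seteqP; split=> //.
have iJ : is_ideal J := is_ideal_gen _.
have [iJ' J'I [n IJ']] := redJ'; have [_ JI _] := redJ.
have [g] := noethR locR iJ'; rewrite set_seq_range; set z := fun i => _ => J'E.
have zJ' i : J' (z i) by rewrite J'E; apply: (@mem_ideal_gen _ (range z)); exists i.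
have xJ i : J (x i) by apply: (@mem_ideal_gen _ (range x)); exists i.
have /choice[Z ZP] i : exists c : 'I_d -> R, z i = \sum_j c j * x j.
  by apply/ideal_gen_rangeP; exact: (J'J _ (zJ' i)).
pose Zk := \matrix_(i, j) pi (Z i j).
have [lft liftK] := residue_lift piP.
have [/row_fullP[Y YZ]|nfull] := boolP (row_full Zk).
  apply: (nakayama locR piP iJ iJ').
  have iA := is_ideal_add iJ' (is_ideal_mul m J).
  apply: ideal_gen_sub => // _ [i _ <-]; apply: (@idealBl _ _ _ (\sum_j lft (Y i j) * z j)) => //.
    apply: sub_ideal_addr => //.
    have -> : x i - \sum_j lft (Y i j) * z j =
       \sum_l ((i == l)%:R - \sum_j lft (Y i j) * Z j l) * x l.
      under [RHS]eq_bigr do rewrite mulrBl.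
      rewrite sumrB; congr (_ - _).
        rewrite (bigD1 i) //= eqxx mul1r big1 ?addr0 // => l.
        by rewrite eq_sym => /negPf->; rewrite mul0r.
      under [RHS]eq_bigr do rewrite big_distrl /=.
      rewrite exchange_big; apply: eq_bigr => j _ /=; rewrite ZP big_distrr /=.
      by apply: eq_bigr => l _; rewrite mulrA.
    apply: (ideal_sum _ (is_ideal_mul _ _)) => l _; apply: mem_ideal_mul => //.
    apply/(residue_eq0 piP); rewrite rmorphB rmorph_nat rmorph_sum.
    have := congr1 (fun A : 'M_d => A i l) YZ; rewrite !mxE => <-.
    by apply/eqP; rewrite subr_eq0; apply/eqP; apply: eq_bigr => j _; rewrite rmorphM liftK mxE.
  apply: sub_ideal_addl; first exact: is_ideal_mul.
  by apply: (ideal_sum _ iJ') => j _; apply: (idealM _ iJ').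
exfalso.
have [c [i0 [ci0 Zc]]] : exists (c : 'I_d -> R) i0, ~ m (c i0) /\
    forall i, m (\sum_j Z i j * c j).
  pose u := nz_row (kermx Zk^T).
  have u0 : u != 0.
    rewrite nz_row_eq0 kermx_eq0 /row_free mxrank_tr.
    by apply: contra nfull => /eqP rk; rewrite /row_full rk.
  have uZ : u *m Zk^T = 0 by apply/sub_kermxP; exact: nz_row_sub.
  have [i0 ui0] : exists i0, u 0 i0 != 0.
    apply: contrapT => /forallNP allu; move/eqP: u0; apply; apply/rowP => j.
    by rewrite mxE; apply/eqP/negPn/negP; exact: allu.
  exists (fun j => lft (u 0 j)), i0; split.
    by move/(residue_eq0 piP); rewrite liftK; exact/eqP.
  move=> i; apply/(residue_eq0 piP); rewrite rmorph_sum.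
  transitivity ((u *m Zk^T) 0 i); last by rewrite uZ mxE.
  by rewrite mxE; apply: eq_bigr => j _; rewrite rmorphM liftK !mxE mulrC.
case: d x depth_d @J redJ J'J iJ JI xJ Z ZP Zk nfull c i0 ci0 Zc
  => [|e] x depth_d J redJ J'J iJ JI xJ Z ZP Zk nfull c i0 ci0 Zc.
  by case: i0 ci0.
have [x' [t [J''J Jt xx']]] := change_generators locR x ci0.
set J'' := ideal_gen (range x') in J''J xx'.
have iJ'' : is_ideal J'' := is_ideal_gen _.
have redJ'' : reduction I J''.
  have iA := is_ideal_add (is_ideal_mul J'' (ideal_exp I n)) (is_ideal_mul m (ideal_exp I n.+1)).
  apply: (nakayama_reduction locR piP (n := n)) => //; first exact: subset_trans JI.
  rewrite {1}IJ'; apply: ideal_mul_sub => // y w J'y Iw.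
  have : ideal_add J'' (ideal_mul m J) y.
    have iB := is_ideal_add iJ'' (is_ideal_mul m J).
    rewrite J'E in J'y; apply: ideal_gen_sub J'y => // _ [i _ <-].
    rewrite -/(z i) ZP; exists (\sum_j Z i j * (x j - c j * t)).
      by apply: (ideal_sum _ iJ'') => j _; apply: (idealM _ iJ'').
    exists ((\sum_j Z i j * c j) * t); first exact: mem_ideal_mul.
    by rewrite big_distrl -big_split; apply: eq_bigr => j _ /=; ring.
  case=> y1 Jy1 [y2 my2 <-]; rewrite mulrDl; apply: (idealD iA).
    by apply: sub_ideal_addl; [exact: is_ideal_mul|exact: mem_ideal_mul].
  apply: sub_ideal_addr; first exact: is_ideal_mul.
  rewrite ideal_expS ideal_mulA; apply: mem_ideal_mul => //.
  exact: ideal_mulS my2.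
have [b mb] := reduction_primary nilI redJ''.
have : (e.+1 <= size (codom x'))%N; last by rewrite size_codom card_ord ltnn.
apply: (depth_ge_size locR piP k_infinite (is_ideal_zero R) (c := b)) depth_d => /=.
- by move=> /eqP; rewrite oner_eq0.
- move=> _ /codomP[j ->]; apply: Im; apply: JI; apply: J''J.
  by apply: (@mem_ideal_gen _ (range x')); exists j.
- by rewrite foldl_adjoin0 set_codom.
Qed.

(** Exactness of the Koszul complex in degree one, read at [Q = 0]: the coefficients of a syzygy are
    combinations of the parameters. *)
Lemma parameters_syzygy d (x : 'I_d -> R) c (r : 'I_d -> R) : depth_ge m d [set 0] ->
  ideal_gen (range x) `<=` m -> ideal_exp m c `<=` ideal_gen (range x) ->
  \sum_i r i * x i = 0 -> forall i, ideal_gen (range x) (r i).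
Proof.
move=> depth_d xm mcx rx i.
have iG := is_ideal_gen (range x).
have xG j : ideal_gen (range x) (x j) by apply: (@mem_ideal_gen _ (range x)); exists j.
pose h := map x (enum 'I_d).
have sizeh : size h = d by rewrite size_map size_enum_ord.
have hE (j : 'I_d) : h`_j = x j.
  by rewrite (nth_map j) ?size_enum_ord // nth_ord_enum.
pose r' n := oapp r 0 (insub n).
have [|||||A [q [Aq _]]] := @parameters_relation _ _ _ _ locR piP k_infinite [set 0] h c r'.
- exact: is_ideal_zero.
- by move=> _ /mapP[j _ ->]; exact: xm.
- by rewrite foldl_adjoin0 set_codom.
- by rewrite sizeh.
- rewrite /= sizeh; apply: etrans rx; apply: eq_bigr => j _.
  by rewrite hE /r' valK.
have [] := Aq i; rewrite sizeh // /r' valK /= => -> ->; rewrite addr0.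
by apply: (ideal_sum _ iG) => j _; apply: (idealM _ iG); rewrite hE.
Qed.

Definition conormal_free d I (x : 'I_d -> R) :=
  forall r : 'I_d -> R, ideal_exp I 2 (\sum_i r i * x i) -> forall i, I (r i).

(** A combination of the [x i] in [I^2] is in [J I], so it can be rewritten with coefficients in
    [I]; the difference is a syzygy, with coefficients in [J] and so in [I]. *)
Lemma conormal_free_of_cap d (x : 'I_d -> R) c I : depth_ge m d [set 0] ->
  is_ideal I -> I `<=` m -> ideal_gen (range x) `<=` I ->
  ideal_exp m c `<=` ideal_gen (range x) ->
  ideal_gen (range x) `&` ideal_exp I 2 = ideal_mul (ideal_gen (range x)) I ->
  conormal_free I x.
Proof.
move=> depth_d iI Im xI mcx capE r I2r i.
have : ideal_mul I (ideal_gen (range x)) (\sum_i r i * x i).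
  rewrite ideal_mulC -capE; split=> //; apply/ideal_gen_rangeP; by exists r.
move=> /(ideal_mul_rangeP _ _ iI)[s [Is sE]].
apply: (@idealBl _ I _ (s i)) => //; apply: (xI).
apply: (parameters_syzygy (r := fun i => r i - s i) depth_d _ mcx).
  exact: subset_trans xI Im.
by under eq_bigr do rewrite mulrBl; rewrite sumrB sE subrr.
Qed.

Lemma cap_of_conormal_free d (x : 'I_d -> R) I : is_ideal I ->
  ideal_gen (range x) `<=` I -> conormal_free I x ->
  ideal_gen (range x) `&` ideal_exp I 2 = ideal_mul (ideal_gen (range x)) I.
Proof.
move=> iI xI freex; apply/seteqP; split; last first.
  apply: ideal_mul_sub => [|y z xy Iz].
    by apply: is_idealI; [exact: is_ideal_gen|exact: is_ideal_exp].
  split; first by apply: (idealMr _ (is_ideal_gen _)).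
  by rewrite ideal_exp2 //; apply: mem_ideal_mul => //; exact: xI.
move=> y [/ideal_gen_rangeP[r ->] /freex Ir].
by rewrite ideal_mulC; apply/ideal_mul_rangeP => //; exists r.
Qed.

End ParameterReductions.

(** * Zariski open conditions *)

Section ZariskiTheory.
Variables (k : fieldType) (d s : nat).
Hypothesis k_infinite : infinite_set [set: k].
Implicit Types (U V : set 'M[k]_(d, s)).

(** A name of its own lets evaluation carry a ring morphism structure; it serves both over [R] and,
    after reduction, over [k]. *)
Definition eval_mx (K : comNzRingType) (A : 'M[K]_(d, s)) : {mpoly K[d * s]} -> K :=
  meval (mxvec A 0).

HB.instance Definition _ (K : comNzRingType) (A : 'M[K]_(d, s)) :=
  GRing.RMorphism.on (eval_mx A).

Lemma zariski_openP U : zariski_open U <->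
  exists F : set {mpoly k[d * s]}, forall A, U A <-> exists2 p, F p & eval_mx A p != 0.
Proof.
split=> -[F FE]; exists F.
  have UE A : ~ U A <-> forall p, F p -> eval_mx A p = 0.
    suff -> : (~ U A) = (~` U) A by rewrite FE.
    by [].
  move=> A; split=> [UA|[p Fp pA] ]; apply: contrapT.
    by move=> /forall2NP noF; apply: ((UE A).2 _ UA) => p Fp; have [//|/negP/negPn/eqP] := noF p.
  by move=> /UE /(_ p Fp) /eqP; apply/negP.
apply/seteqP; split=> A /=.
  by move=> UA p Fp; apply: contrapT => /eqP pA; apply: UA; apply/FE; exists p.
by move=> allF /FE[p /allF pA]; rewrite /eval_mx pA eqxx.
Qed.

Lemma zariski_openI U V : zariski_open U -> zariski_open V -> zariski_open (U `&` V).
Proof.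
move=> /zariski_openP[F FP] /zariski_openP[G GP]; apply/zariski_openP.
exists [set p * q | p in F & q in G] => A; split.
  move=> [/FP[p Fp pA] /GP[q Gq qA]]; exists (p * q); first by exists p => //; exists q.
  by rewrite rmorphM mulf_neq0.
move=> [_ [p Fp [q Gq <-]]]; rewrite rmorphM mulf_eq0 negb_or => /andP[pA qA].
by split; [apply/FP; exists p|apply/GP; exists q].
Qed.

Lemma eval_mx_nonroot (p : {mpoly k[d * s]}) : p != 0 -> exists A, eval_mx A p != 0.
Proof.
move=> /(mpoly_nonroot k_infinite)[v vp]; exists (vec_mx (\row_i v i)).
by rewrite /eval_mx vec_mxK (meval_eq (v2 := v)) // => i; rewrite mxE.
Qed.

(** Irreducibility of affine space over an infinite field: a product of two nonzero polynomials is
    nonzero, so it has a nonroot. *)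
Lemma zariski_open_dense U : zariski_open U -> U !=set0 -> zariski_dense U.
Proof.
move=> /zariski_openP[F FP] [A /FP[p Fp pA]] V /zariski_openP[G GP] [B /GP[q Gq qB]].
have nz (C : 'M[k]_(d, s)) r : eval_mx C r != 0 -> r != 0.
  by apply: contra => /eqP->; rewrite rmorph0.
have [C] := eval_mx_nonroot (mulf_neq0 (nz _ _ pA) (nz _ _ qB)).
rewrite rmorphM mulf_eq0 negb_or => /andP[pC qC].
by exists C; split; [apply/FP; exists p|apply/GP; exists q].
Qed.

(** Arbitrary constant matrices [P] and [Q] replace the selection of rows and columns of a minor;
    they come from the rank normal form of [A]. *)
Lemma rank_minor (p q r : nat) (A : 'M[k]_(p, q)) :
  (r <= \rank A)%N <-> exists (P : 'M_(r, p)) (Q : 'M_(q, r)), \det (P *m A *m Q) != 0.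
Proof.
split=> [lerA|[P [Q]]]; last first.
  rewrite -unitfE -unitmxE -row_free_unit /row_free => /eqP <-.
  by apply: leq_trans (mxrankM_maxl _ _) _; exact: mxrankM_maxr.
exists (pid_mx r *m invmx (col_ebase A)), (invmx (row_ebase A) *m pid_mx r).
rewrite -{2}(mulmx_ebase A) !mulmxA mulmxKV ?col_ebase_unit //.
rewrite -!mulmxA mulKVmx ?row_ebase_unit // mulmxA !mul_pid_mx.
have lerp := leq_trans lerA (rank_leq_row A).
have lerq := leq_trans lerA (rank_leq_col A).
rewrite (minn_idPl lerA) (minn_idPr lerp) minnn (minn_idPr lerq).
by rewrite pid_mx_1 det1 oner_neq0.
Qed.

Lemma zariski_open_rank (p q r : nat) (C : 'M[{mpoly k[d * s]}]_(p, q)) :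
  zariski_open [set A | (r <= \rank (map_mx (eval_mx A) C))%N].
Proof.
apply/zariski_openP.
exists [set f | exists (P : 'M[k]_(r, p)) (Q : 'M[k]_(q, r)),
  f = \det (map_mx (@mpolyC _ _) P *m C *m map_mx (@mpolyC _ _) Q)] => A /=.
have evalE (P : 'M[k]_(r, p)) (Q : 'M[k]_(q, r)) :
    eval_mx A (\det (map_mx (@mpolyC _ _) P *m C *m map_mx (@mpolyC _ _) Q)) =
    \det (P *m map_mx (eval_mx A) C *m Q).
  rewrite -det_map_mx !map_mxM -!map_mx_comp; congr (\det (_ *m _ *m _)).
    by apply/matrixP => i j; rewrite !mxE /= /eval_mx mevalC.
  by apply/matrixP => i j; rewrite !mxE /= /eval_mx mevalC.
rewrite rank_minor; split=> [[P [Q PQ]]|[_ [P [Q ->]]]].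
  by eexists; [exists P, Q; reflexivity|rewrite evalE].
by rewrite evalE; exists P, Q.
Qed.

End ZariskiTheory.

(** * Conditions determined by residues of coefficients *)

Section Generic.
Variables (R : comNzRingType) (m : set R) (k : fieldType) (pi : {rmorphism R -> k}).
Hypotheses (locR : noetherian_local m) (piP : residue_map m pi).
Hypothesis k_infinite : infinite_set [set: k].
Variables (d s : nat).
Implicit Types (I J K M N P Q H : set R) (x y z : R) (L : 'M[R]_(d, s)).
Implicit Types (f : 'M[R]_(d, s) -> R).

Lemma eval_mx_residue L (p : {mpoly R[d * s]}) :
  pi (eval_mx L p) = eval_mx (map_mx pi L) (map_mpoly pi p).
Proof.
rewrite /eval_mx mevalE [in RHS]/map_mpoly /mmap raddf_sum raddf_sum /=.
apply: eq_bigr => u _; rewrite rmorphM rmorph_prod mevalM mevalC; congr (_ * _).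
rewrite /mmap1 rmorph_prod; apply: eq_bigr => i _.
by rewrite !rmorphXn /= mevalXU -map_mxvec mxE.
Qed.

(** Nonemptiness stands for density here, by [zariski_open_dense]; it is witnessed by a single
    matrix. *)
Definition generically (P : 'M[R]_(d, s) -> Prop) := exists U : set 'M[k]_(d, s),
  [/\ zariski_open U, U !=set0 & forall L, U (map_mx pi L) -> P L].

Lemma generically_and (P Q : 'M[R]_(d, s) -> Prop) : generically P -> generically Q ->
  generically (fun L => P L /\ Q L).
Proof.
move=> [U [oU U0 UP]] [V [oV V0 VQ]]; exists (U `&` V); split.
- exact: zariski_openI.
- exact: zariski_open_dense.
- by move=> L [/UP ? /VQ].
Qed.

Lemma generically_sub (P Q : 'M[R]_(d, s) -> Prop) :
  (forall L, P L -> Q L) -> generically P -> generically Q.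
Proof. by move=> PQ [U [oU U0 UP]]; exists U; split=> // L /UP/PQ. Qed.

Definition residue_mx p q (C : 'M[{mpoly R[d * s]}]_(p, q)) L :=
  map_mx (fun g => pi (eval_mx L g)) C.

Lemma residue_mxE p q (C : 'M[{mpoly R[d * s]}]_(p, q)) L :
  residue_mx C L = map_mx (eval_mx (map_mx pi L)) (map_mx (map_mpoly pi) C).
Proof. by apply/matrixP => i j; rewrite !mxE eval_mx_residue. Qed.

Lemma generically_rank p q r (C : 'M[{mpoly R[d * s]}]_(p, q)) L0 :
  (r <= \rank (residue_mx C L0))%N ->
  generically (fun L => r <= \rank (residue_mx C L))%N.
Proof.
move=> rC; exists [set A | (r <= \rank (map_mx (eval_mx A) (map_mx (map_mpoly pi) C)))%N].
split; first exact: zariski_open_rank.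
  by exists (map_mx pi L0); rewrite /= -residue_mxE.
by move=> L; rewrite /= -residue_mxE.
Qed.

(** [f] is a polynomial function of the entries of [L] with coefficients in [M]. One expression
    serves all [L], which is more than having all values in [M]. *)
Definition poly_in M f := exists S : seq ({mpoly R[d * s]} * R),
  (forall p, p \in S -> M p.2) /\ forall L, f L = \sum_(p <- S) eval_mx L p.1 * p.2.

Lemma poly_in_mem M f L : is_ideal M -> poly_in M f -> M (f L).
Proof.
move=> iM [S [SM ->]]; rewrite big_seq; apply: (ideal_sum _ iM) => p pS.
by apply: (idealM _ iM); exact: SM.
Qed.

Lemma poly_in_ext M f f' : f =1 f' -> poly_in M f -> poly_in M f'.
Proof. by move=> ff' [S [SM fE]]; exists S; split=> // L; rewrite -ff'. Qed.

Lemma poly_in_const M x : M x -> poly_in M (fun=> x).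
Proof.
move=> Mx; exists [:: (1, x)]; split=> [p|L]; first by rewrite inE => /eqP->.
by rewrite big_seq1 rmorph1 mul1r.
Qed.

Lemma poly_inD M f f' : poly_in M f -> poly_in M f' -> poly_in M (fun L => f L + f' L).
Proof.
move=> [S [SM fE]] [S' [SM' fE']]; exists (S ++ S'); split=> [p|L].
  by rewrite mem_cat => /orP[/SM|/SM'].
by rewrite big_cat fE fE'.
Qed.

Lemma poly_inZ M g f : poly_in M f -> poly_in M (fun L => eval_mx L g * f L).
Proof.
move=> [S [SM fE]]; exists [seq (g * p.1, p.2) | p <- S]; split=> [_ /mapP[p /SM Mp ->]//|L].
by rewrite fE big_map big_distrr; apply: eq_bigr => p _ /=; rewrite rmorphM mulrA.
Qed.

Lemma poly_in_sum M (T : Type) (r : seq T) (f : T -> 'M[R]_(d, s) -> R) :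
  (forall t, poly_in M (f t)) -> poly_in M (fun L => \sum_(t <- r) f t L).
Proof.
move=> fM; elim: r => [|t r IHr].
  by exists [::]; split=> // L; rewrite !big_nil.
apply: (@poly_in_ext _ (fun L => f t L + \sum_(t <- r) f t L)) => [L|].
  by rewrite big_cons.
exact: poly_inD.
Qed.

Lemma poly_inB M f f' : poly_in M f -> poly_in M f' -> poly_in M (fun L => f L - f' L).
Proof.
move=> fM fM'; apply: (@poly_in_ext _ (fun L => f L + eval_mx L (-1) * f' L)).
  by move=> L; rewrite rmorphN rmorph1 mulN1r.
by apply: poly_inD => //; exact: poly_inZ.
Qed.

Lemma poly_in_mul K M g x : (forall u, K g@_u) -> M x ->
  poly_in (ideal_mul K M) (fun L => eval_mx L g * x).
Proof.
move=> gK Mx; exists [seq ('X_[u], g@_u * x) | u <- msupp g]; split=> [_ /mapP[u _ ->]/=|L].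
  exact: mem_ideal_mul.
rewrite big_map /eval_mx mevalE big_distrl; apply: eq_bigr => u _ /=.
by rewrite mevalX; ring.
Qed.

(** When [N] contains [m M], these are lifts to [M] of a [k]-basis of the image of [M] in
    [R / N]. *)
Definition residue_basis M N v (e : 'I_v -> R) := [/\ forall l, M (e l),
  forall x, M x -> exists c : 'I_v -> R, N (x - \sum_l c l * e l)
  & forall c : 'I_v -> R, N (\sum_l c l * e l) -> forall l, m (c l)].

Lemma exists_residue_basis M N : is_ideal M -> is_ideal N ->
  exists v (e : 'I_v -> R), residue_basis M N e.
Proof.
move=> iM iN; have [g] := noethR locR iM; rewrite set_seq_range.
move: (size g) (fun i : 'I_(size g) => g`_i) => v e ME.
have : (forall l, M (e l)) /\
       forall x, M x -> exists c : 'I_v -> R, N (x - \sum_l c l * e l).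
  rewrite ME; split=> [l|x /ideal_gen_rangeP[c ->]].
    by apply: (@mem_ideal_gen _ (range e)); exists l.
  by exists c; rewrite subrr; exact: ideal0.
elim: v e {ME} => [|v IHv] e [Me eM]; first by exists 0%N, e; split=> // c _ [].
have [indep|] := pselect (forall c : 'I_v.+1 -> R, N (\sum_l c l * e l) -> forall l, m (c l)).
  by exists v.+1, e.
move=> /existsNP[c /not_implyP[Nc /existsNP[l0 mc]]].
apply: (IHv (fun l => e (lift l0 l))); split=> // x /eM[b Nb].
have [w wc] := local_unit locR mc.
exists (fun l => b (lift l0 l) - b l0 * w * c (lift l0 l)).
have : N (x - \sum_l b l * e l + b l0 * w * \sum_l c l * e l).
  by apply: (idealD iN) => //; exact: idealM.
have split_l0 (F : 'I_v.+1 -> R) : \sum_l F l = F l0 + \sum_l F (lift l0 l).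
  by rewrite (bigD1_ord l0).
have -> : \sum_l (b (lift l0 l) - b l0 * w * c (lift l0 l)) * e (lift l0 l) =
    \sum_l b (lift l0 l) * e (lift l0 l) - b l0 * w * \sum_l c (lift l0 l) * e (lift l0 l).
  by rewrite big_distrr -sumrB; apply: eq_bigr => l _ /=; ring.
have e0 : b l0 * w * (c l0 * e l0) = b l0 * e l0 by rewrite -[RHS]mulr1 -wc; ring.
by rewrite !split_l0 mulrDr e0 => Nx; congr (N _): Nx; ring.
Qed.

End Generic.

(** * Spanning and independence in polynomial families *)

Section GenericSpan.
Variables (R : comNzRingType) (m : set R) (k : fieldType) (pi : {rmorphism R -> k}).
Hypotheses (locR : noetherian_local m) (piP : residue_map m pi).
Hypothesis k_infinite : infinite_set [set: k].
Variables (d s : nat).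
Implicit Types (I J K M N P Q H : set R) (x y z : R) (L : 'M[R]_(d, s)).
Implicit Types (f : 'M[R]_(d, s) -> R).

Definition spans M N (T : finType) (y : T -> R) :=
  M `<=` ideal_add N (ideal_gen (range y)).

Definition residue_free N (T : finType) (y : T -> R) :=
  forall c : T -> R, N (\sum_t c t * y t) -> forall t, m (c t).

Lemma spansP M N (T : finType) (y : T -> R) :
  spans M N y <-> forall x, M x -> exists c : T -> R, N (x - \sum_t c t * y t).
Proof.
split=> Msp x /Msp; last first.
  move=> [c Nx]; exists (x - \sum_t c t * y t) => //.
  by exists (\sum_t c t * y t); [apply/ideal_gen_rangeP; exists c|rewrite subrK].
by case=> u Nu [_ /ideal_gen_rangeP[c ->] <-]; exists c; rewrite addrK.
Qed.

Section Coordinates.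
Variables (M N : set R) (v : nat) (e : 'I_v -> R).
Hypotheses (iM : is_ideal M) (iN : is_ideal N).
Hypothesis mMN : forall t x, m t -> M x -> N (t * x).
Hypothesis eP : residue_basis m M N e.

(** Only the finitely many coefficients of [f] are expanded in [e], so the coordinates are
    polynomials in [L] and the remainder is polynomial with coefficients in [N]. *)
Lemma poly_in_coordinates f : poly_in M f -> exists C : 'I_v -> {mpoly R[d * s]},
  poly_in N (fun L => f L - \sum_l eval_mx L (C l) * e l).
Proof.
move=> [S [SM fE]]; have [_ eM _] := eP.
have /choice[c cP] x : exists c : 'I_v -> R, M x -> N (x - \sum_l c l * e l).
  have [/eM[c Nx]|nMx] := pselect (M x); first by exists c.
  by exists (fun=> 0).
exists (fun l => \sum_(p <- S) p.1 * (c p.2 l)%:MP).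
exists [seq (p.1, p.2 - \sum_l c p.2 l * e l) | p <- S]; split.
  by move=> _ /mapP[p /SM Mp ->]; exact: cP.
move=> L; rewrite fE big_map /=; under [RHS]eq_bigr do rewrite mulrBr.
rewrite sumrB; congr (_ - _); under [RHS]eq_bigr do rewrite big_distrr /=.
rewrite exchange_big; apply: eq_bigr => l _ /=.
rewrite rmorph_sum big_distrl; apply: eq_bigr => p _ /=.
by rewrite rmorphM /= {2}/eval_mx mevalC mulrA.
Qed.

Section Rank.
Variables (q : nat) (y : 'I_q -> R) (C : 'M[R]_(q, v)).
Hypothesis yP : forall b, N (y b - \sum_l C b l * e l).

(** Turns congruences modulo [N] into linear algebra over [k]: as [N] contains [m M], only residues
    of coefficients matter. *)
Lemma coordinatesP (a : 'I_v -> R) (c : 'I_q -> R) :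
  N (\sum_l a l * e l - \sum_b c b * y b) <->
  (\row_l pi (a l)) = (\row_b pi (c b)) *m map_mx pi C.
Proof.
have [Me _ e_free] := eP.
have E : \sum_l (a l - \sum_b c b * C b l) * e l =
    \sum_l a l * e l - \sum_b c b * y b + \sum_b c b * (y b - \sum_l C b l * e l).
  rewrite [X in _ = _ + X](eq_bigr (fun b => c b * y b - \sum_l c b * C b l * e l)).
    rewrite sumrB addrA subrK exchange_big -sumrB; apply: eq_bigr => l _ /=.
    by rewrite mulrBl big_distrl.
  by move=> b _; rewrite mulrBr big_distrr /=; congr (_ - _); apply: eq_bigr => l _; rewrite mulrA.
have Nrem : N (\sum_b c b * (y b - \sum_l C b l * e l)).
  by apply: (ideal_sum _ iN) => b _; apply: (idealM _ iN).
split=> [Nac|ac].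
  apply/rowP => l; rewrite !mxE.
  have /e_free/(_ l)/(residue_eq0 piP) : N (\sum_l (a l - \sum_b c b * C b l) * e l).
    by rewrite E; exact: idealD.
  rewrite rmorphB rmorph_sum => /eqP; rewrite subr_eq0 => /eqP->.
  by apply: eq_bigr => b _; rewrite rmorphM !mxE.
rewrite -[X in N X](addrK (\sum_b c b * (y b - \sum_l C b l * e l))) -E.
apply: (idealB iN) => //; apply: (ideal_sum _ iN) => l _; apply: mMN => //.
apply/(residue_eq0 piP); rewrite rmorphB rmorph_sum.
have := congr1 (fun A : 'rV__ => A 0 l) ac; rewrite /= !mxE => ->.
apply/eqP; rewrite subr_eq0; apply/eqP; apply: eq_bigr => b _.
by rewrite rmorphM !mxE.
Qed.

Lemma spans_rank : spans M N y <-> (v <= \rank (map_mx pi C))%N.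
Proof.
have [Me eM _] := eP; have [lft liftK] := residue_lift piP.
have -> : (v <= \rank (map_mx pi C))%N = row_full (map_mx pi C).
  by rewrite /row_full eqn_leq rank_leq_col.
rewrite spansP; split=> [ysp|/row_fullP[X XC] x /eM[a Nx]].
  have /choice[c cP] l : exists c : 'I_q -> R, N (e l - \sum_b c b * y b) by exact: ysp.
  apply/row_fullP; exists (\matrix_(l, b) pi (c l b)); apply/row_matrixP => l.
  rewrite row_mul; have : N (\sum_j (l == j)%:R * e j - \sum_b c l b * y b).
    rewrite (bigD1 l) //= eqxx mul1r big1 ?addr0 // => j.
    by rewrite eq_sym => /negPf->; rewrite mul0r.
  move=> /coordinatesP; set A := \row__ _; set B := \row__ _.
  have -> : row l (\matrix_(l, b) pi (c l b)) = B by apply/rowP => b; rewrite !mxE.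
  by move=> <-; apply/rowP => j; rewrite !mxE rmorph_nat.
pose c := (\row_l pi (a l)) *m X.
exists (fun b => lft (c 0 b)).
have -> : x - \sum_b lft (c 0 b) * y b =
  (x - \sum_l a l * e l) + (\sum_l a l * e l - \sum_b lft (c 0 b) * y b) by ring.
apply: (idealD iN) => //; apply/coordinatesP.
rewrite (_ : \row_b _ = c); first by rewrite -mulmxA XC mulmx1.
by apply/rowP => b; rewrite mxE liftK.
Qed.

Lemma residue_free_rank : residue_free N y <-> (q <= \rank (map_mx pi C))%N.
Proof.
have [lft liftK] := residue_lift piP.
have -> : (q <= \rank (map_mx pi C))%N = row_free (map_mx pi C).
  by rewrite /row_free eqn_leq rank_leq_row.
have relP (c : 'I_q -> R) : N (\sum_b c b * y b) <-> (\row_b pi (c b)) *m map_mx pi C = 0.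
  have E : N (\sum_b c b * y b) <-> N (\sum_l 0 * e l - \sum_b c b * y b).
    rewrite [X in _ <-> N (X - _)]big1 ?sub0r => [|l _]; last by rewrite mul0r.
    by split=> Nc; [exact: idealN|rewrite -[X in N X]opprK; exact: idealN].
  rewrite E (coordinatesP (fun=> 0)).
  have -> : (\row_(l < v) pi 0) = 0 :> 'rV_v by apply/rowP => l; rewrite !mxE rmorph0.
  by split=> /esym.
split=> [yfree|Cfree c /relP].
  rewrite -kermx_eq0 -nz_row_eq0; apply/eqP/rowP => b; rewrite mxE.
  set u := nz_row _; rewrite -[LHS]liftK; apply/(residue_eq0 piP).
  apply: (yfree (fun b => lft (u 0 b))); apply/relP.
  rewrite (_ : \row__ _ = u); first by apply/sub_kermxP; exact: nz_row_sub.
  by apply/rowP => j; rewrite mxE liftK.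
move=> /eqP; rewrite mulmx_free_eq0 // => /eqP c0 b.
by apply/(residue_eq0 piP); have := congr1 (fun A : 'rV__ => A 0 b) c0; rewrite !mxE.
Qed.

End Rank.

End Coordinates.

Section Families.
Variables (M N : set R).
Hypotheses (iM : is_ideal M) (iN : is_ideal N).
Hypothesis mMN : forall t x, m t -> M x -> N (t * x).

Lemma family_coordinates q (F : 'I_q -> 'M[R]_(d, s) -> R) v (e : 'I_v -> R) :
  residue_basis m M N e -> (forall b, poly_in M (F b)) ->
  exists C : 'M[{mpoly R[d * s]}]_(q, v),
    forall b, poly_in N (fun L => F b L - \sum_l eval_mx L (C b l) * e l).
Proof.
move=> eP FM.
have /choice[C CP] b := poly_in_coordinates eP (FM b).
exists (\matrix_(b, l) C b l) => b; apply: poly_in_ext (CP b) => L.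
by congr (_ - _); apply: eq_bigr => l _; rewrite mxE.
Qed.

Lemma residue_mx_comp p q (C : 'M[{mpoly R[d * s]}]_(p, q)) L :
  residue_mx pi C L = map_mx pi (map_mx (eval_mx L) C).
Proof. by apply/matrixP => i j; rewrite !mxE. Qed.

(** Spanning means that the polynomial coordinate matrix has full column rank, a condition bounding
    the rank from below. Independence, below, is full row rank. *)
Lemma generically_spans (T : finType) (F : T -> 'M[R]_(d, s) -> R) L0 :
  (forall t, poly_in M (F t)) -> spans M N (F ^~ L0) ->
  generically pi (fun L => spans M N (F ^~ L)).
Proof.
have enumE L : spans M N (F ^~ L) = spans M N (fun b : 'I_#|T| => F (enum_val b) L).
  by rewrite /spans range_enum_val.
move=> FM; rewrite enumE => F0.
have [v [e eP]] := exists_residue_basis locR iM iN.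
have [C CP] := family_coordinates (F := fun b : 'I_#|T| => F (enum_val b)) eP (fun b => FM _).
have Crank L : spans M N (F ^~ L) <-> (v <= \rank (residue_mx pi C L))%N.
  rewrite enumE residue_mx_comp; apply: (spans_rank iN mMN eP) => b.
  congr (N (_ - _)): (poly_in_mem L iN (CP b)).
  by apply: eq_bigr => l _; rewrite mxE.
apply: (generically_sub (fun L => (Crank L).2)); apply: (generically_rank (L0 := L0)).
by apply/Crank; rewrite enumE.
Qed.

Lemma generically_residue_free (T : finType) (F : T -> 'M[R]_(d, s) -> R) L0 :
  (forall t, poly_in M (F t)) -> residue_free N (F ^~ L0) ->
  generically pi (fun L => residue_free N (F ^~ L)).
Proof.
have enumE L : residue_free N (F ^~ L) <-> residue_free N (fun b : 'I_#|T| => F (enum_val b) L).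
  have sumE (c : T -> R) : \sum_t c t * F t L =
      \sum_(b < #|T|) c (enum_val b) * F (enum_val b) L.
    exact: (reindex _ (onW_bij _ (enum_val_bij T))).
  split=> free c.
    move=> Nc b; have := free (c \o enum_rank); rewrite sumE.
    under eq_bigr do rewrite /= enum_valK.
    by move=> /(_ Nc (enum_val b)); rewrite /= enum_valK.
  rewrite sumE => /(free (c \o enum_val)) mc t.
  by have := mc (enum_rank t); rewrite /= enum_rankK.
move=> FM /enumE F0.
have [v [e eP]] := exists_residue_basis locR iM iN.
have [C CP] := family_coordinates (F := fun b : 'I_#|T| => F (enum_val b)) eP (fun b => FM _).
have Crank L : residue_free N (F ^~ L) <-> (#|T| <= \rank (residue_mx pi C L))%N.
  rewrite enumE residue_mx_comp; apply: (residue_free_rank iN mMN eP) => b.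
  congr (N (_ - _)): (poly_in_mem L iN (CP b)).
  by apply: eq_bigr => l _; rewrite mxE.
apply: (generically_sub (fun L => (Crank L).2)); apply: (generically_rank (L0 := L0)).
by apply/Crank/enumE.
Qed.

End Families.

End GenericSpan.

(** The rows of [P *m A] already span those of [A], so [A = X *m P *m A]. Then
    [A *m Q = X *m (P *m A *m Q)] determines [X], and the adjugate clears the denominator, leaving
    an identity polynomial in [A]. *)
Lemma det_scale_rank (k : fieldType) (p q r : nat) (A : 'M[k]_(p, q))
    (P : 'M_(r, p)) (Q : 'M_(q, r)) :
  (\rank A <= r)%N -> \det (P *m A *m Q) != 0 ->
  \det (P *m A *m Q) *: A = A *m Q *m \adj (P *m A *m Q) *m P *m A.
Proof.
move=> rA; rewrite -unitfE -unitmxE -row_free_unit => /eqP rD.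
have rPA : (r <= \rank (P *m A))%N by rewrite -{1}rD mxrankM_maxl.
have /submxP[X AE] : (A <= P *m A)%MS.
  have [_ <-] := mxrank_leqif_sup (submxMl P A).
  by rewrite eqn_leq (leq_trans rA rPA) mxrankM_maxr.
have -> : A *m Q = X *m (P *m A *m Q) by rewrite {1}AE !mulmxA.
by rewrite -(mulmxA X) mul_mx_adj mul_mx_scalar -!scalemxAl -(mulmxA X) -AE.
Qed.

(** * Deformation of relations to second order *)

Section SecondOrder.
Variables (R : comNzRingType) (m : set R) (k : fieldType) (pi : {rmorphism R -> k}).
Hypotheses (locR : noetherian_local m) (piP : residue_map m pi).
Hypothesis k_infinite : infinite_set [set: k].
Variables (d s : nat).
Implicit Types (I J K M N P Q H E : set R) (x y z : R) (L : 'M[R]_(d, s)).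

Lemma exists_lift_mx p q (A : 'M[k]_(p, q)) : exists B : 'M[R]_(p, q), map_mx pi B = A.
Proof.
have [lft liftK] := residue_lift piP; exists (map_mx lft A).
by apply/matrixP => i j; rewrite !mxE.
Qed.

Lemma poly_in_scale K M (f : 'M[R]_(d, s) -> R) t : K t -> poly_in M f ->
  poly_in (ideal_mul K M) (fun L => t * f L).
Proof.
move=> Kt [S [SM fE]]; exists [seq (p.1, t * p.2) | p <- S]; split.
  by move=> _ /mapP[p /SM Mp ->]; exact: mem_ideal_mul.
by move=> L; rewrite fE big_map big_distrr; apply: eq_bigr => p _ /=; rewrite mulrCA.
Qed.

(* If the F_b L0 span M / mM up to one vector, and never all of it, then the
   rank of their coordinates is locally constant at L0, so that the linear
   relations among the F_b L modulo mM deform with L. The generators of mM that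
   come from these relations at L0 then deform too. *)
Lemma generically_spans_next M E q (F : 'I_q -> 'M[R]_(d, s) -> R) w L0 :
  is_ideal M -> is_ideal E -> E `<=` ideal_mul m M -> M w ->
  (forall b, poly_in M (F b)) ->
  M `<=` adjoin (ideal_add (ideal_mul m M) (ideal_gen (range (F ^~ L0)))) w ->
  (forall L, ~ spans M (ideal_mul m M) (F ^~ L)) ->
  spans (ideal_mul m M) E (F ^~ L0) ->
  generically pi (fun L =>
    spans (ideal_mul m M) (ideal_add (ideal_mul m (ideal_mul m M)) E) (F ^~ L)).
Proof.
set M1 := ideal_mul m M; set N1 := ideal_add (ideal_mul m M1) E => iM iE EM1 Mw FM spw nsp sp1.
have iM1 : is_ideal M1 := is_ideal_mul m M.
have iN1 : is_ideal N1 := is_ideal_add (is_ideal_mul _ _) iE.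
have iQ := is_ideal_max locR.
have mM t x : m t -> M x -> M1 (t * x) by exact: mem_ideal_mul.
have mM1 t x : m t -> M1 x -> N1 (t * x).
  by move=> mt M1x; apply: sub_ideal_addl => //; exact: mem_ideal_mul.
have [v [e eP]] := exists_residue_basis locR iM iM1.
have [C CP] := family_coordinates eP FM.
have CPL L b : M1 (F b L - \sum_l map_mx (eval_mx L) C b l * e l).
  by congr (M1 (_ - _)): (poly_in_mem L iM1 (CP b)); apply: eq_bigr => l _; rewrite mxE.
have spCr L : spans M M1 (F ^~ L) <-> (v <= \rank (residue_mx pi C L))%N.
  by rewrite residue_mx_comp; exact: (spans_rank piP iM1 mM eP (CPL L)).
have rank_lt L : (\rank (residue_mx pi C L) < v)%N.
  by rewrite ltnNge; apply/negP => /spCr; exact: nsp.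
have v_gt0 : (0 < v)%N by apply: leq_ltn_trans (rank_lt L0).
(* Adding [w] fills the quotient, so the identity of size [v] is a multiple of the coordinate matrix
   at [L0] plus a matrix of rank at most one. *)
have rank_L0 : (v.-1 <= \rank (residue_mx pi C L0))%N.
  have [Me eM _] := eP; have [a Ma] := eM w Mw.
  have /choice[X XP] l : exists X : 'I_q -> R, exists u,
      (\row_j pi (l == j)%:R : 'rV_v) = (\row_b pi (X b)) *m residue_mx pi C L0
        + pi u *: \row_j pi (a j).
    have [u [z M1z [_ /ideal_gen_rangeP[X ->] eE]]] := spw _ (Me l).
    exists X, u; rewrite residue_mx_comp.
    have /(coordinatesP piP iM1 mM eP (CPL L0)) <- :
        M1 (\sum_j ((l == j)%:R - u * a j) * e j - \sum_b X b * F b L0).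
      have -> : \sum_j ((l == j)%:R - u * a j) * e j - \sum_b X b * F b L0 =
          z + u * (w - \sum_j a j * e j); last by apply: (idealD iM1) => //; exact: (idealM _ iM1).
      under eq_bigr do rewrite mulrBl -mulrA.
      rewrite sumrB -big_distrr (bigD1 l) //= eqxx mul1r big1 ?addr0.
        by rewrite -[z](addrK (\sum_b X b * F b L0)) eE; ring.
      by move=> j; rewrite eq_sym => /negPf->; rewrite mul0r.
    by apply/rowP => j; rewrite !mxE rmorphB rmorphM subrK.
  have /choice[u uP] := XP.
  pose X' := \matrix_(l, b) pi (X l b); pose u' := \col_l pi (u l).
  have E1 : 1%:M = X' *m residue_mx pi C L0 + u' *m \row_j pi (a j).
    apply/row_matrixP => l; rewrite linearD /= !row_mul.
    have -> : row l X' = \row_b pi (X l b) by apply/rowP => b; rewrite !mxE.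
    have -> : row l u' *m \row_j pi (a j) = pi (u l) *: \row_j pi (a j).
      by apply/rowP => j; rewrite !mxE big_ord1 !mxE.
    by rewrite -uP; apply/rowP => j; rewrite !mxE rmorph_nat.
  have := mxrank_add (X' *m residue_mx pi C L0) (u' *m \row_j pi (a j)).
  rewrite -E1 mxrank1 => lev; rewrite -ltnS prednK //.
  have rk1 : (\rank (X' *m residue_mx pi C L0) <= \rank (residue_mx pi C L0))%N.
    exact: mxrankM_maxr.
  have rk2 : (\rank (u' *m \row_j pi (a j)) <= 1)%N.
    by apply: leq_trans (mxrankM_maxr _ _) _; exact: rank_leq_row.
  by apply: leq_trans lev _; apply: leq_trans (leq_add rk1 rk2) _; rewrite addn1.
have [Pk [Qk]] := (rank_minor _ _).1 rank_L0.
have [P0 <-] := exists_lift_mx Pk; have [Q0 <-] := exists_lift_mx Qk => {Pk Qk} detL0.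
pose cst p q (A : 'M[R]_(p, q)) : 'M[{mpoly R[d * s]}]_(p, q) := map_mx (@mpolyC _ _) A.
have cstE p' q' (A : 'M[R]_(p', q')) L : map_mx (eval_mx L) (cst _ _ A) = A.
  by apply/matrixP => i j; rewrite !mxE /= /eval_mx mevalC.
(* [det_scale_rank] transcribed to matrices of polynomials over [R], with lifted constants [P0] and
   [Q0]; [Psi] is the defect of the identity. *)
pose D := cst _ _ P0 *m C *m cst _ _ Q0.
pose G := C *m cst _ _ Q0 *m \adj D *m cst _ _ P0.
pose Psi := \det D *: C - G *m C.
have DE L : map_mx pi (map_mx (eval_mx L) D) =
    map_mx pi P0 *m residue_mx pi C L *m map_mx pi Q0.
  by rewrite !map_mxM !cstE residue_mx_comp.
have detDE L : pi (eval_mx L (\det D)) =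
    \det (map_mx pi P0 *m residue_mx pi C L *m map_mx pi Q0).
  by rewrite -DE !det_map_mx.
(* Otherwise some residue matrix makes both [det D] and this entry of [Psi] nonzero, although the
   rank there is at most [v.-1] and the identity holds. Hence the coefficients of [Psi] lie in
   [m]. *)
have Psi0 b l : map_mpoly pi (Psi b l) = 0.
  apply/eqP/negPn/negP => Psi_n0.
  have det_n0 : map_mpoly pi (\det D) != 0.
    apply/eqP => det0; move: detL0; rewrite -detDE eval_mx_residue det0 rmorph0.
    by rewrite eqxx.
  have [A] := eval_mx_nonroot k_infinite (mulf_neq0 det_n0 Psi_n0).
  have [L <-] := exists_lift_mx A.
  rewrite rmorphM /= mulf_eq0 negb_or -!eval_mx_residue => /andP[detL].
  have -> : pi (eval_mx L (Psi b l)) = map_mx pi (map_mx (eval_mx L) Psi) b l by rewrite !mxE.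
  suff -> : map_mx pi (map_mx (eval_mx L) Psi) = 0 by rewrite mxE eqxx.
  rewrite detDE in detL.
  rewrite /Psi /G !map_mxB !map_mxZ !map_mxM !map_mx_adj DE !cstE -residue_mx_comp.
  rewrite -[X in X *: _]/(pi (eval_mx L (\det D))) detDE det_scale_rank ?subrr //.
  by rewrite -ltnS prednK.
have mPsi b l u : m (Psi b l)@_u.
  by apply/(residue_eq0 piP); rewrite -mcoeff_map_mpoly Psi0 mcoeff0.
(* The relations applied to the [F b] themselves. The coordinates are given by [Psi], so this is
   polynomial with coefficients in [m M], and [generically_spans] can be used one level lower. *)
pose F1 b L := eval_mx L (\det D) * F b L - \sum_b' eval_mx L (G b b') * F b' L.
have F1M b : poly_in M1 (F1 b).
  have FE L : F1 b L = \sum_l eval_mx L (Psi b l) * e l +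
     (eval_mx L (\det D) * (F b L - \sum_l eval_mx L (C b l) * e l)
      - \sum_b' eval_mx L (G b b') * (F b' L - \sum_l eval_mx L (C b' l) * e l)).
    have -> : \sum_l eval_mx L (Psi b l) * e l =
        eval_mx L (\det D) * (\sum_l eval_mx L (C b l) * e l)
        - \sum_b' eval_mx L (G b b') * (\sum_l eval_mx L (C b' l) * e l).
      rewrite big_distrr; under [X in _ = _ - X]eq_bigr do rewrite big_distrr.
      rewrite exchange_big -sumrB; apply: eq_bigr => l _ /=.
      rewrite !mxE rmorphB rmorphM mulrBl mulrA; congr (_ - _).
      rewrite rmorph_sum big_distrl.
      by apply: eq_bigr => b' _; rewrite rmorphM mulrA.
    rewrite /F1 (eq_bigr (fun b' => eval_mx L (G b b') * (\sum_l eval_mx L (C b' l) * e l)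
      + eval_mx L (G b b') * (F b' L - \sum_l eval_mx L (C b' l) * e l))).
      by rewrite big_split /=; ring.
    by move=> b' _; rewrite -mulrDr addrC subrK.
  apply: poly_in_ext (fun L => esym (FE L)) _; apply: poly_inD.
    by apply: poly_in_sum => l; apply: poly_in_mul => //; case: eP.
  apply: poly_inB; first exact: poly_inZ.
  by apply: poly_in_sum => b'; exact: poly_inZ.
have [g mE] := max_gen locR.
(* At [L0], the deformed relations and the multiples of the [F b] by generators of [m] produce, up
   to the unit [det D], every combination of the [F b] lying in [m M]. *)
pose FF (t : 'I_q + 'I_(size g) * 'I_q) L :=
  match t with inl b => F1 b L | inr (i, b) => g`_i * F b L end.
have mg (i : 'I_(size g)) : m g`_i by rewrite mE; apply: mem_ideal_gen; exact: mem_nth.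
have FFM t : poly_in M1 (FF t).
  by case: t => [b|[i b]]; [exact: F1M|exact: poly_in_scale].
have FF_F L t : ideal_gen (range (F ^~ L)) (FF t L).
  have iG := is_ideal_gen (range (F ^~ L)).
  have FG b : ideal_gen (range (F ^~ L)) (F b L).
    by apply: (@mem_ideal_gen _ (range (F ^~ L))); exists b.
  case: t => [b|[i b]]; last exact: (idealM _ iG).
  apply: (idealB iG); first exact: (idealM _ iG).
  by apply: (ideal_sum _ iG) => b' _; exact: (idealM _ iG).
have N1M1 : N1 `<=` M1.
  by apply: ideal_add_sub => //; exact: ideal_mul_subr.
suff FF0 : spans M1 N1 (FF ^~ L0).
  have gFF := generically_spans locR piP iM1 iN1 mM1 FFM FF0.
  apply: generically_sub gFF => L spL x /spL[u Nu [y FFy <-]].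
  exists u => //; exists y => //; apply: ideal_gen_sub FFy; first exact: is_ideal_gen.
  by move=> _ [t _ <-].
have iG := is_ideal_gen (range (FF ^~ L0)).
have iB := is_ideal_add iN1 iG.
have FFB t : ideal_add N1 (ideal_gen (range (FF ^~ L0))) (FF t L0).
  by apply: sub_ideal_addr => //; apply: (@mem_ideal_gen _ (range (FF ^~ L0))); exists t.
have mFB u b : m u -> ideal_add N1 (ideal_gen (range (FF ^~ L0))) (u * F b L0).
  rewrite mE => /ideal_gen_seqP[c ->]; rewrite big_distrl /=.
  apply: (ideal_sum _ iB) => i _; rewrite -mulrA; apply: (idealM _ iB).
  exact: (FFB (inr (i, b))).
move=> y M1y; have [c Ec] := (spansP _ _ _).1 sp1 y M1y.
apply: (idealBl iB).
  by apply: sub_ideal_addl => //; apply: sub_ideal_addr Ec; exact: is_ideal_mul.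
have mDet : ~ m (eval_mx L0 (\det D)).
  by move/(residue_eq0 piP)/eqP; apply/negP; rewrite detDE.
apply: (local_unitM locR iB mDet).
have relc l : m (\sum_b c b * eval_mx L0 (C b l)).
  have M1c : M1 (\sum_j 0 * e j - \sum_b - c b * F b L0).
    rewrite big1 ?sub0r => [|j _]; last by rewrite mul0r.
    under eq_bigr do rewrite mulNr; rewrite sumrN opprK.
    by apply: (idealBr iM1 _ M1y); exact: EM1.
  have /(coordinatesP piP iM1 mM eP (CPL L0)) := M1c.
  move=> /(congr1 (fun A : 'rV__ => A 0 l)); rewrite !mxE rmorph0 => rel.
  apply/(residue_eq0 piP)/eqP; rewrite rmorph_sum -oppr_eq0 -sumrN; apply/eqP.
  rewrite [RHS]rel.
  by apply: eq_bigr => b _; rewrite !mxE rmorphN rmorphM mulNr.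
have -> : eval_mx L0 (\det D) * \sum_b c b * F b L0 = \sum_b c b * F1 b L0 +
    \sum_b' (\sum_b c b * eval_mx L0 (G b b')) * F b' L0.
  under [X in _ = _ + X]eq_bigr do rewrite big_distrl.
  rewrite exchange_big -big_split big_distrr; apply: eq_bigr => b _ /=.
  rewrite /F1 mulrBr big_distrr /=.
  rewrite [X in _ = _ + X](eq_bigr (fun b' => c b * (eval_mx L0 (G b b') * F b' L0))).
    by rewrite subrK mulrCA.
  by move=> b' _; rewrite mulrA.
apply: (idealD iB); apply: (ideal_sum _ iB) => b _.
  by apply: (idealM _ iB); exact: (FFB (inl b)).
apply: mFB.
(* [G] has [C] as its left factor, so the relation [relc] puts these coefficients in [m]. *)
have -> : \sum_b0 c b0 * eval_mx L0 (G b0 b) = \sum_l (\sum_b0 c b0 * eval_mx L0 (C b0 l)) *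
    eval_mx L0 ((cst _ _ Q0 *m \adj D *m cst _ _ P0) l b).
  under [RHS]eq_bigr do rewrite big_distrl.
  rewrite exchange_big; apply: eq_bigr => b0 _ /=.
  rewrite /G -!mulmxA mxE rmorph_sum big_distrr; apply: eq_bigr => l _ /=.
  by rewrite rmorphM mulrA !mulmxA.
by apply: (ideal_sum _ iQ) => l _; apply: (idealMr _ iQ).
Qed.

End SecondOrder.

(** * Stretched ideals *)

Section Length.
Variables (R : comNzRingType) (m : set R).
Hypothesis locR : noetherian_local m.
Implicit Types (I J K M N P Q H : set R) (x y z w : R).

(** The image of [w] spans [M / N] over the residue field, so an ideal above [N] that contains an
    element of [M] outside [N] contains a unit multiple of [w] modulo [N], hence all of [M]. *)
Lemma has_length_le1 M N w : is_ideal M -> is_ideal N -> N `<=` M -> M w ->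
  (forall t x, m t -> M x -> N (t * x)) -> M `<=` adjoin N w ->
  exists2 l, has_length M N l & (l <= 1)%N.
Proof.
move=> iM iN NM Mw mMN Mw_gen.
have top C x : is_ideal C -> N `<=` C -> M x -> ~ N x -> C x -> M `<=` C.
  move=> iC NC Mx nNx Cx; have [r Nr] := Mw_gen x Mx.
  have mr : ~ m r by move=> mr; apply: nNx; apply: (idealBl iN Nr); exact: mMN.
  have Cw : C w.
    by apply: (local_unitM locR iC mr); apply: (idealBr iC _ Cx); exact: NC.
  by apply: (subset_trans Mw_gen); exact: adjoin_sub.
have [MN|nMN] := pselect (M `<=` N).
  exists 0%N => //; split; first by exists (fun=> N); split=> // i _; split.
  case=> // n [C [CP Clt]]; exfalso.
  have [_ _ C1M] := CP 1%N isT; have [_ NC0 _] := CP 0%N isT.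
  by have [_] := Clt 0%N isT; apply=> x /C1M/MN/NC0.
exists 1%N => //; split.
  exists (fun i => if i is 0%N then N else M); split=> [[|i] _|[|i]//]; split=> //.
case=> [|[|n]] // [C [CP Clt]]; exfalso.
have [_ /existsPNP[x C1x nC0x]] : C 0%N `<` C 1%N by exact: Clt.
have [_ nC2] : C 1%N `<` C 2%N by exact: Clt.
have [iC1 NC1 C1M] := CP 1%N isT; have [_ NC0 _] := CP 0%N isT.
have [_ _ C2M] := CP 2%N isT.
apply: nC2; apply: (subset_trans C2M); apply: (top _ x) => //; first exact: C1M.
by move/NC0.
Qed.

(** Any element of [M] outside [N] generates [M] modulo [N]. If [t * x] were outside [N] with [t] in
    [m], then [x] would be [r * t * x] modulo [N], and the unit [1 - r * t] would put [x] in [N]. *)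
Lemma le1_has_length M N l : is_ideal M -> is_ideal N -> N `<=` M ->
  has_length M N l -> (l <= 1)%N ->
  (forall t x, m t -> M x -> N (t * x)) /\ exists2 w, M w & M `<=` adjoin N w.
Proof.
move=> iM iN NM [_ lmax] l1.
have simple C : is_ideal C -> N `<=` C -> C `<=` M -> C <> N -> M `<=` C.
  move=> iC NC CM neCN; apply: contrapT => nMC.
  suff : (2 <= l)%N by move/leq_trans/(_ l1).
  apply: lmax; exists (fun i => match i with 0%N => N | 1%N => C | _ => M end).
  split; first by move=> [|[|i]] _; split.
  move=> [|[|//]] _ /=; split=> // CN; apply: neCN; apply/seteqP; split=> //.
have [MN|/existsPNP[w Mw nNw]] := pselect (M `<=` N).
  split; first by move=> t x _ /MN; exact: idealM.
  by exists 0; [exact: ideal0|exact: subset_trans MN (@sub_adjoin _ _ _)].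
have adjM x : M x -> adjoin N x `<=` M by move=> Mx; exact: adjoin_sub.
have big x : M x -> ~ N x -> M `<=` adjoin N x.
  move=> Mx nNx; apply: simple; [exact: is_ideal_adjoin|exact: sub_adjoin|exact: adjM|].
  by move=> eqN; apply: nNx; rewrite -eqN; exact: mem_adjoin.
split; last by exists w => //; exact: big.
move=> t x mt Mx; apply: contrapT => nNtx.
have [r Nr] : adjoin N (t * x) x by apply: big => //; exact: idealM.
have m1rt : ~ m (1 - r * t).
  have [_ [iQ m1 _] _] := locR.
  by move=> m1rt; apply: m1; apply: (idealBl iQ m1rt); exact: idealM.
apply: nNtx; apply: (idealM _ iN); apply: (local_unitM locR iN m1rt).
by rewrite mulrBl mul1r -mulrA.
Qed.

End Length.

(** * The open conditions for stretchedness *)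

Section Stretched.
Variables (R : comNzRingType) (m : set R) (k : fieldType) (pi : {rmorphism R -> k}).
Hypotheses (locR : noetherian_local m) (piP : residue_map m pi).
Hypothesis k_infinite : infinite_set [set: k].
Variables (I : set R) (d s : nat) (a : 'I_s -> R).
Hypotheses (iI : is_ideal I) (Im : I `<=` m).
Hypothesis nilI : forall x, m x -> exists n, I (x ^+ n).
Hypothesis IE : I = ideal_gen (range a).
Hypothesis depth_d : depth_ge m d [set 0].
Implicit Types (J K M N P Q H : set R) (x y z w : R) (L : 'M[R]_(d, s)).

Let iQ : is_ideal m := is_ideal_max locR.

Definition comb L (i : 'I_d) := \sum_(j < s) L i j * a j.

Definition comb_ideal L := ideal_gen (range (comb L)).

Lemma is_ideal_comb L : is_ideal (comb_ideal L). Proof. exact: is_ideal_gen. Qed.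

Lemma gen_mem j : I (a j).
Proof. by rewrite IE; apply: (@mem_ideal_gen _ (range a)); exists j. Qed.

Lemma comb_mem L i : I (comb L i).
Proof. by apply: (ideal_sum _ iI) => j _; apply: (idealM _ iI); exact: gen_mem. Qed.

Lemma comb_ideal_sub L : comb_ideal L `<=` I.
Proof. by apply: ideal_gen_sub => // _ [i _ <-]; exact: comb_mem. Qed.

Lemma poly_in_comb M i y : (forall j, M (a j * y)) -> poly_in M (fun L => comb L i * y).
Proof.
move=> May; apply: (@poly_in_ext _ _ _ _
  (fun L => \sum_(j < s) eval_mx L 'X_(mxvec_index i j) * (a j * y))) => [L|].
  rewrite /comb big_distrl; apply: eq_bigr => j _ /=.
  by rewrite /eval_mx mevalXU mxvecE mulrA.
by apply: poly_in_sum => j; apply: poly_inZ; exact: poly_in_const.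
Qed.

Lemma exists_comb (h : 'I_d -> R) : (forall i, I (h i)) -> exists L, comb L =1 h.
Proof.
move=> Ih; have /choice[c cP] i : exists c : 'I_s -> R, h i = \sum_j c j * a j.
  by apply/ideal_gen_rangeP; rewrite -IE.
exists (\matrix_(i, j) c i j) => i; rewrite cP.
by apply: eq_bigr => j _; rewrite mxE.
Qed.

Lemma ideal_mul_range (T T' : finType) (x : T -> R) (y : T' -> R) :
  ideal_mul (ideal_gen (range x)) (ideal_gen (range y)) =
  ideal_gen (range (fun p : T * T' => x p.1 * y p.2)).
Proof.
rewrite ideal_mul_gen; congr ideal_gen; apply/seteqP; split.
  by move=> _ [_ [t _ <-] [_ [t' _ <-] <-]]; exists (t, t').
by move=> _ [[t t'] _ <-]; exists (x t); [exists t|exists (y t'); [exists t'|]].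
Qed.

(** The exponent [n] found at [L0] is kept. Products of the [x_i] with generators of [I^n] span
    [I^(n+1)] modulo [m I^(n+1)] generically; Nakayama gives a reduction, and its [d] generators
    make it minimal. *)
Lemma generically_reduction L0 : reduction I (comb_ideal L0) ->
  generically pi (fun L => minimal_reduction I (comb_ideal L)).
Proof.
move=> [_ _ [n redL0]].
have [g] := noethR locR (is_ideal_exp I n); rewrite set_seq_range.
set y := fun i => _ => InE.
have yI i : ideal_exp I n (y i).
  by rewrite InE; apply: (@mem_ideal_gen _ (range y)); exists i.
pose F (t : 'I_d * 'I_(size g)) L := comb L t.1 * y t.2.
have FE L : ideal_gen (range (F ^~ L)) = ideal_mul (comb_ideal L) (ideal_exp I n).
  by rewrite InE ideal_mul_range.
have mI t x : m t -> ideal_exp I n.+1 x -> ideal_mul m (ideal_exp I n.+1) (t * x).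
  exact: mem_ideal_mul.
have FI t : poly_in (ideal_exp I n.+1) (F t).
  by apply: poly_in_comb => j; apply: mem_ideal_mul; [exact: gen_mem|exact: yI].
have spL0 : spans (ideal_exp I n.+1) (ideal_mul m (ideal_exp I n.+1)) (F ^~ L0).
  by rewrite /spans FE -redL0; apply: sub_ideal_addr; exact: is_ideal_mul.
have := generically_spans locR piP (is_ideal_exp I n.+1) (is_ideal_mul _ _) mI FI spL0.
apply: generically_sub => L spL.
apply: (parameters_minimal_reduction locR piP k_infinite depth_d) => //.
apply: (nakayama_reduction locR piP (n := n)) => //; [exact: is_ideal_comb|exact: comb_ideal_sub|].
move=> x /spL; rewrite FE => -[u mu [v Jv <-]].
by exists v => //; exists u => //; rewrite addrC.
Qed.

Let socle := [set y | forall t, m t -> I (t * y)].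

Let is_ideal_socle : is_ideal socle.
Proof.
split=> [t _|x y Ix Iy t mt|r x Ix t mt]; first by rewrite mulr0; exact: ideal0.
  by rewrite mulrDr; apply: (idealD iI); [exact: Ix|exact: Iy].
by rewrite mulrCA; apply: (idealM _ iI); exact: Ix.
Qed.

(** Take [p] least with [m^(p+1) r] inside [I]; some [u] in [m^p] then moves the whole vector into
    the socle of [R / I] without killing it. *)
Lemma exists_socle_multiple (T : finType) (r : T -> R) t0 : ~ I (r t0) ->
  exists u, (forall t, socle (u * r t)) /\ exists t, ~ I (u * r t).
Proof.
move=> nIr; have [c mc] := exists_ideal_exp_sub locR iI iQ nilI.
have ex : exists c, `[< forall u, ideal_exp m c u -> forall t, I (u * r t) >].
  by exists c; apply/asboolP => u /mc Iu t; exact: idealMr.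
case: (ex_minnP ex) => -[|p] /asboolP nil_r min_r.
  by exfalso; apply: nIr; rewrite -[r t0]mul1r; exact: nil_r.
have /existsNP[u /not_implyP[mu /existsNP[t nI]]] :
    ~ forall u, ideal_exp m p u -> forall t, I (u * r t).
  by move=> all; have := min_r p (asboolT all); rewrite ltnn.
exists u; split; last by exists t.
by move=> t' x mx; rewrite mulrA; apply: nil_r; exact: mem_ideal_mul.
Qed.

(** Freeness over [R / I] is not directly a rank condition over [k]. A bad relation has a nonzero
    multiple with coefficients in the socle, so it suffices that the products of the [x_i] with a
    basis of the socle stay independent over [k]. *)
Lemma generically_conormal_free L0 : conormal_free I (comb L0) ->
  generically pi (fun L => conormal_free I (comb L)).
Proof.
move=> freeL0; have [v [e [Se eS e_free]]] := exists_residue_basis locR is_ideal_socle iI.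
have iI2 := is_ideal_exp I 2.
have I2M x y : I x -> I y -> ideal_exp I 2 (x * y).
  by move=> Ix Iy; rewrite ideal_exp2 //; exact: mem_ideal_mul.
(* Modulo [I^2] this is the socle of [I / I^2]; it contains the products to be tested, and [m M]
   lies in [I^2]. *)
pose M := [set y | I y /\ forall t, m t -> ideal_exp I 2 (t * y)].
have iM : is_ideal M.
  split=> [|x y [Ix mx] [Iy my]|r x [Ix mx]]; split; try exact: ideal0.
  - by move=> t _; rewrite mulr0; exact: ideal0.
  - exact: idealD.
  - by move=> t mt; rewrite mulrDr; apply: (idealD iI2); [exact: mx|exact: my].
  - exact: idealM.
  - by move=> t mt; rewrite mulrCA; apply: (idealM _ iI2); exact: mx.
have mM t x : m t -> M x -> ideal_exp I 2 (t * x) by move=> mt [_]; apply.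
pose F (t : 'I_d * 'I_v) L := comb L t.1 * e t.2.
have FM t : poly_in M (F t).
  apply: poly_in_comb => j; split; first by apply: (idealMr _ iI); exact: gen_mem.
  move=> u mu; rewrite mulrCA; apply: I2M; first exact: gen_mem.
  exact: Se.
have FE (c : 'I_d * 'I_v -> R) L : \sum_t c t * F t L =
    \sum_i (\sum_l c (i, l) * e l) * comb L i.
  transitivity (\sum_i \sum_l c (i, l) * F (i, l) L).
    by rewrite pair_bigA; apply: eq_bigr => -[].
  apply: eq_bigr => i _; rewrite big_distrl; apply: eq_bigr => l _ /=.
  by rewrite /F /=; ring.
have FL0 : residue_free m (ideal_exp I 2) (F ^~ L0).
  by move=> c; rewrite FE => /freeL0 Ic [i l]; exact: (e_free (fun l => c (i, l))).
have := generically_residue_free locR piP iM iI2 mM FM FL0.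
apply: generically_sub => L freeL r Ir i; apply: contrapT => nIr.
have [u [Su [i' nIu]]] := exists_socle_multiple nIr.
have /choice[c cP] j : exists c : 'I_v -> R, I (u * r j - \sum_l c l * e l) by exact: eS.
apply: nIu; apply: (idealBl iI (cP i')); apply: (ideal_sum _ iI) => l _.
apply: Se; apply: (freeL (fun t => c t.1 t.2) _ (i', l)); rewrite FE /=.
apply: (idealBr iI2 (x := u * \sum_j r j * comb L j)); last exact: (idealM _ iI2).
rewrite big_distrr -sumrB; apply: (ideal_sum _ iI2) => j _ /=.
by rewrite mulrA -mulrBl; apply: I2M => //; exact: comb_mem.
Qed.

Lemma cap_eq_mul L : conormal_free I (comb L) ->
  comb_ideal L `&` ideal_exp I 2 = ideal_mul (comb_ideal L) I.
Proof. by apply: cap_of_conormal_free => //; exact: comb_ideal_sub. Qed.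

Let I2 := ideal_exp I 2.
Let I3 := ideal_exp I 3.
Let F (b : 'I_#|{: 'I_d * 'I_s}|) L := comb L (enum_val b).1 * a (enum_val b).2.

Let FE L : ideal_gen (range (F ^~ L)) = ideal_mul (comb_ideal L) I.
Proof.
rewrite [in RHS]IE ideal_mul_range.
by rewrite (range_enum_val (fun p : 'I_d * 'I_s => comb L p.1 * a p.2)).
Qed.

Let F_poly b : poly_in I2 (F b).
Proof.
apply: poly_in_comb => j; rewrite /I2 ideal_exp2 //.
by apply: mem_ideal_mul; exact: gen_mem.
Qed.

Let iI2 : is_ideal I2 := is_ideal_exp I 2.
Let iI3 : is_ideal I3 := is_ideal_exp I 3.
Let mI2 t x : m t -> I2 x -> ideal_mul m I2 (t * x).
Proof. exact: mem_ideal_mul. Qed.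

Let I3_sub : I3 `<=` ideal_mul m I2.
Proof. by apply: ideal_mulS. Qed.

Let JI_sub L : ideal_mul (comb_ideal L) I `<=` I2.
Proof. by rewrite /I2 ideal_exp2 //; apply: ideal_mulS => //; exact: comb_ideal_sub. Qed.

Lemma generically_length L0 :
  (exists2 l, has_length I2 (ideal_add (ideal_mul (comb_ideal L0) I) I3) l & (l <= 1)%N) ->
  generically pi (fun L =>
    exists2 l, has_length I2 (ideal_add (ideal_mul (comb_ideal L) I) I3) l & (l <= 1)%N).
Proof.
pose N L := ideal_add (ideal_mul (comb_ideal L) I) I3.
have iN L : is_ideal (N L) by apply: is_ideal_add => //; exact: is_ideal_mul.
have NI2 L : N L `<=` I2.
  by apply: ideal_add_sub; [exact: iI2|exact: JI_sub|exact: ideal_exp_decr].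
have JIN L : ideal_mul (comb_ideal L) I `<=` N L by exact: sub_ideal_addl.
have I3N L : I3 `<=` N L by apply: sub_ideal_addr; exact: is_ideal_mul.
move=> [l lenl l1]; have [mN [w I2w wN]] := le1_has_length locR iI2 (iN L0) (NI2 L0) lenl l1.
(* [L1] is any matrix, not necessarily [L0]: one point of spanning makes spanning generic, and then
   [J I = I^2], so that the quotient is zero. *)
have [[L1 spL1]|nsp] := pselect (exists L, spans I2 (ideal_mul m I2) (F ^~ L)).
  have := generically_spans locR piP iI2 (is_ideal_mul _ _) mI2 F_poly spL1.
  apply: generically_sub => L; rewrite /spans FE => spL.
  have I2JI : I2 `<=` ideal_mul (comb_ideal L) I.
    apply: (nakayama locR piP) => //; first exact: is_ideal_mul.
    by move=> x /spL[u mu [v Jv <-]]; exists v => //; exists u => //; rewrite addrC.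
  apply: (@has_length_le1 _ _ locR I2 (N L) 0) => //; first exact: (ideal0 iI2).
    by move=> t x _ I2x; apply: JIN; apply: I2JI; exact: (idealM _ iI2).
  by move=> x /I2JI/JIN; exact: sub_adjoin.
have sp1 : spans (ideal_mul m I2) I3 (F ^~ L0).
  rewrite /spans FE; apply: ideal_mul_sub => [|t x mt I2x].
    by apply: is_ideal_add => //; exact: is_ideal_mul.
  by have [u Ju [v I3v <-]] := mN t x mt I2x; exists v => //; exists u => //; rewrite addrC.
pose mF L := ideal_add (ideal_mul m I2) (ideal_gen (range (F ^~ L))).
have imF L : is_ideal (mF L) := is_ideal_add (is_ideal_mul _ _) (is_ideal_gen _).
have NmF L : N L `<=` mF L.
  apply: ideal_add_sub => //; first by rewrite -FE; apply: sub_ideal_addr; exact: is_ideal_mul.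
  by apply: (subset_trans I3_sub); apply: sub_ideal_addl; exact: is_ideal_gen.
have spw : I2 `<=` adjoin (mF L0) w by move=> x /wN[r /NmF]; exists r.
have nspL L : ~ spans I2 (ideal_mul m I2) (F ^~ L) by move=> spL; apply: nsp; exists L.
have gen1 := generically_spans_next locR piP k_infinite iI2 iI3 I3_sub I2w F_poly spw nspL sp1.
(* The generator [w] found at [L0] is fixed and added to the family: it still generates [I^2] modulo
   [J I + m I^2] for general [L]. *)
pose F' (t : option 'I_#|{: 'I_d * 'I_s}|) L := if t is Some b then F b L else w.
have F'_poly t : poly_in I2 (F' t) by case: t => [b|]; [exact: F_poly|exact: poly_in_const].
have F'E L : ideal_gen (range (F' ^~ L)) = adjoin (ideal_gen (range (F ^~ L))) w.
  have iG := is_ideal_gen (range (F ^~ L)); have iA := is_ideal_adjoin w iG.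
  have iG' := is_ideal_gen (range (F' ^~ L)).
  have F'G t : ideal_gen (range (F' ^~ L)) (F' t L).
    by apply: (@mem_ideal_gen _ (range (F' ^~ L))); exists t.
  apply/seteqP; split.
    apply: ideal_gen_sub => // _ [[b|] _ <-]; last exact: mem_adjoin.
    by apply: sub_adjoin; apply: (@mem_ideal_gen _ (range (F ^~ L))); exists b.
  apply: adjoin_sub => //; last exact: (F'G None).
  by apply: ideal_gen_sub => // _ [b _ <-]; exact: (F'G (Some b)).
have sp' : spans I2 (ideal_mul m I2) (F' ^~ L0).
  move=> x /spw[r [u mu [v Fv uvE]]]; exists u => //; exists (v + r * w).
    by rewrite F'E; exists r; rewrite addrK.
  by rewrite addrA uvE subrK.
have gen2 := generically_spans locR piP iI2 (is_ideal_mul _ _) mI2 F'_poly sp'.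
apply: generically_sub (generically_and k_infinite gen1 gen2) => L [gL1 gL2].
(* The term in [m^2 I^2] left by [gen1] is absorbed by Nakayama applied to [m I^2]. *)
have mI2N : ideal_mul m I2 `<=` N L.
  apply: (nakayama locR piP) => //; first exact: is_ideal_mul.
  move=> x /gL1[_ [u mu [v I3v <-]] [z]]; rewrite FE => Jz <-.
  exists (z + v); first by apply: (idealD (iN L)); [exact: JIN|exact: I3N].
  by exists u => //; ring.
apply: (@has_length_le1 _ _ locR I2 (N L) w) => //.
  by move=> t x mt I2x; apply: mI2N; exact: mem_ideal_mul.
move=> x /gL2[u /mI2N Nu [v]]; rewrite F'E FE => -[r JIr] <-.
by exists r; rewrite -addrA; apply: (idealD (iN L)) => //; exact: JIN.
Qed.

End Stretched.

Theorem corollary5p6 (R : comNzRingType) (m : set R)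
    (k : fieldType) (pi : {rmorphism R -> k}) (d : nat)
    (R_CM : cohen_macaulay_local m) (R_dim : has_krull_dim R d)
    (k_residue : residue_map m pi) (R_equichar : same_characteristic R k)
    (k_infinite : infinite_set [set: k])
    (I : set R) (I_primary : primary_to m I)
    (s : nat) (a : 'I_s -> R) (I_gen : I = ideal_gen (range a))
    (H : set R) (I_stretched : stretched I H) :
  for_general_minimal_reduction pi d a (fun J => stretched I J).
Proof.
have [locR _] := R_CM; have [[iI _ _] radI] := I_primary.
have [depth_d [y [sizey ym [c mcy]]]] := cohen_macaulay_parameters locR R_CM R_dim.
have Im : I `<=` m by move=> x Ix; rewrite -radI; exists 1%N.
have nilI x : m x -> exists n, I (x ^+ n) by rewrite -radI.
have [minH capH lenH] := I_stretched; have [redH _] := minH.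
have [h HE] := minimal_reduction_generators locR k_residue k_infinite sizey mcy ym iI Im nilI minH.
have [_ HI _] := redH.
(* Having [d] generators in [I], the given [H] is itself a member of the family, and each generic
   condition is derived from its validity there. *)
have [L0 L0h] : exists L0 : 'M_(d, s), comb a L0 =1 h.
  by apply: (exists_comb I_gen) => i; apply: HI; rewrite HE;
    apply: (@mem_ideal_gen _ (range h)); exists i.
have HL0 : H = comb_ideal a L0.
  by rewrite HE /comb_ideal (_ : comb a L0 = h) //; exact/funext.
have [b mbH] := reduction_primary locR nilI redH.
rewrite {}HL0 {h HE L0h} in minH capH lenH redH HI mbH.
have freeL0 : conormal_free I (comb a L0).
  exact: (conormal_free_of_cap locR k_residue k_infinite depth_d iI Im HI mbH capH).
(* The length condition is transported in terms of [J I]; [cap_eq_mul] restores the intersection for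
   general [J]. *)
rewrite capH in lenH.
have gen_min := generically_reduction locR k_residue k_infinite iI Im nilI I_gen depth_d redH.
have gen_free := generically_conormal_free locR k_residue iI nilI I_gen freeL0.
have gen_len := generically_length locR k_residue k_infinite iI Im I_gen lenH.
have [U [oU U0 UP]] :=
  generically_and k_infinite gen_min (generically_and k_infinite gen_free gen_len).
exists U; split=> //; first exact: (zariski_open_dense k_infinite oU U0).
move=> L /UP[minL [freeL lenL]].
by split=> //; rewrite cap_eq_mul.
Qed.
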